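(* Let $p\in\mathbb{R}[x_0,x_1,x_2]$ be an irreducible hyperbolic polynomial with respect to $e\in\mathbb{R}^3$. Then $$C_e(p)^\vee=\operatorname{cc}\big(\mathcal{V}(p)^\ast(\mathbb{R})\cap H_{e,+}\big),$$ where $\mathcal{V}(p)^\ast(\mathbb{R})$ denotes the set of real points of the affine cone over the projective dual variety of $\mathcal{V}(p)$, and $\operatorname{cc}(S)$ denotes the convex cone generated by $S$.
   Context: A homogeneous polynomial $p\in\mathbb{R}[x_0,\dots,x_n]$ is hyperbolic with respect to $e\in\mathbb{R}^{n+1}$ if $p(e)\ne0$ and the univariate polynomial $p(te-a)$ in $t$ has only real roots for every $a\in\mathbb{R}^{n+1}$; by convention one always assumes $p(e)>0$. Its hyperbolicity cone is $C_e(p)=\{a\in\mathbb{R}^{n+1}:\text{all roots of }p(te-a)\text{ are non-negative}\}$, a closed convex cone with $e$ in its interior, and $C_e(p)^\vee=\{\ell\in(\mathbb{R}^{n+1})^\ast : \ell(x)\ge0\ \forall x\in C_e(p)\}$. Here $n=2$. $H_{e,+}=\{\ell\in(\mathbb{R}^{n+1})^\ast:\ell(e)\ge0\}$. A convex cone is a nonempty convex set closed under multiplication by scalars $\lambda\ge0$; $\operatorname{cc}(S)$ is the smallest convex cone containing $S$ (no closure is taken). Varieties are subsets of complex affine or projective space defined by polynomials with real coefficients, and the Zariski topology is the one with these as closed sets. For an irreducible projective variety $X\subset\mathbb{P}^n$, its projective dual variety is the Zariski closure in $(\mathbb{P}^n)^\ast$ of the set of hyperplanes $H$ with $T_xX\subset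 H$ for some regular point $x$ of $X$. $\mathcal{V}(p)$ is the zero set of $p$; $\mathcal{V}(p)^\ast\subset(\mathbb{C}^{n+1})^\ast$ is the affine cone (union of the corresponding lines) over the projective dual variety of the projective hypersurface defined by $p$ in $\mathbb{P}^n$. *)

(* Defs.v *)
From mathcomp Require Export all_boot all_order all_algebra.
From mathcomp Require Export classical_sets reals convex.
From mathcomp Require Export complex mpoly.

Set Implicit Arguments.
Unset Strict Implicit.
Unset Printing Implicit Defensive.

Import GRing.Theory.

Local Open Scope classical_set_scope.
Local Open Scope ring_scope.

(* Conventions.  Points of K^n and linear forms on K^n are both row vectors
   over K, a form being given by its coordinates in the dual of the standard
   basis.  A polynomial p is evaluated at x : 'rV[K]_n as p.@[x 0].
   A subset of a projective space over R[i] is given by the set of all nonzero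
   homogeneous coordinate vectors of its points. *)

Definition pairing (K : pzRingType) (n : nat) (l x : 'rV[K]_n) : K :=
  \sum_(i < n) l 0 i * x 0 i.

Section Polynomials.
Variables (R : realType) (n : nat).
Implicit Types (p q r : {mpoly R[n]}) (a e : 'rV[R]_n).

Definition homogeneous p : Prop := exists d : nat, p \is d.-homog.

Definition irreducible_mpoly p : Prop :=
  [/\ p != 0, p \isn't a GRing.unit &
      forall q r, p = q * r -> q \is a GRing.unit \/ r \is a GRing.unit].

(* the univariate polynomial p(te - a) in t *)
Definition restrict_line p e a : {poly R} :=
  mmap polyC (fun i => e 0 i *: 'X - (a 0 i)%:P) p.

(* the roots are taken in the algebraic closure R[i] of R *)
Definition line_root p e a (z : R[i]) : Prop :=
  root (map_poly (real_complex R) (restrict_line p e a)) z.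

Definition hyperbolic p e : Prop :=
  [/\ homogeneous p, p.@[e 0] != 0 &
      forall a z, line_root p e a z -> z \is Num.real].

(* 0 <= z in R[i] means that z is real and non-negative *)
Definition hyperbolicity_cone p e : set 'rV[R]_n :=
  [set a | forall z, line_root p e a z -> 0 <= z].

End Polynomials.

Section Cones.
Variables (R : realType) (n : nat).
Implicit Types (S C : set 'rV[R]_n).

Definition convex_cone C : Prop :=
  [/\ C !=set0, convex_set C &
      forall (k : R) x, 0 <= k -> C x -> C (k *: x)].

Definition cc S : set 'rV[R]_n := smallest convex_cone S.

Definition dual_cone C : set 'rV[R]_n :=
  [set l | forall x, C x -> 0 <= pairing l x].

Definition half_space (e : 'rV[R]_n) : set 'rV[R]_n :=
  [set l | 0 <= pairing l e].

End Cones.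

Section ProjectiveVarieties.
Variables (R : realType) (n : nat).
Implicit Types (f : {mpoly R[n]}) (F : set {mpoly R[n]}) (X : set 'rV[R[i]]_n).

Definition ceval f (x : 'rV[R[i]]_n) : R[i] :=
  (map_mpoly (real_complex R) f).@[x 0].

Definition proj_zeros F : set 'rV[R[i]]_n :=
  [set x | x != 0 /\ forall f, F f -> ceval f x = 0].

Definition zariski_closed X : Prop :=
  exists2 F, F `<=` @homogeneous R n & X = proj_zeros F.

Definition zariski_closure X : set 'rV[R[i]]_n := smallest zariski_closed X.

(* the homogeneous elements of the vanishing ideal of X *)
Definition vanishing X : set {mpoly R[n]} :=
  [set f | homogeneous f /\ forall x, X x -> ceval f x = 0].

(* The linear subspace of R[i]^n whose projectivization is the embedded
   projective tangent space T_x X. *)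
Definition tangent_space X (x : 'rV[R[i]]_n) : set 'rV[R[i]]_n :=
  [set v | forall f, vanishing X f ->
     \sum_(i < n) ceval (f^`M(i)) x * v 0 i = 0].

(* A point of an irreducible variety X is regular (nonsingular) if its tangent
   space has the smallest dimension among all points of X (this minimum is
   dim X, or dim X + 1 for the affine tangent spaces used here); see
   Shafarevich, Basic Algebraic Geometry 1, II.1.4. *)
Definition regular_point X (x : 'rV[R[i]]_n) : Prop :=
  X x /\ exists2 U : {vspace 'rV[R[i]]_n}, tangent_space X x = [set` U] &
    forall y (V : {vspace 'rV[R[i]]_n}),
      X y -> tangent_space X y = [set` V] -> (\dim U <= \dim V)%N.

Definition hyperplane (l : 'rV[R[i]]_n) : set 'rV[R[i]]_n :=
  [set v | pairing l v = 0].

(* the projective dual variety of an irreducible projective variety X *)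
Definition dual_variety X : set 'rV[R[i]]_n :=
  zariski_closure
    [set l | l != 0 /\
      exists2 x, regular_point X x & tangent_space X x `<=` hyperplane l].

Definition affine_cone X : set 'rV[R[i]]_n :=
  [set v | exists k x, X x /\ v = k *: x].

Definition real_points X : set 'rV[R]_n :=
  [set a | X (map_mx (real_complex R) a)].

End ProjectiveVarieties.

(* Main.v *)
(* Let l be a real form with l(e) >= 0 in the affine cone over the dual curve.  If
   l were negative somewhere on the hyperbolicity cone, it would vanish at an
   interior point c of that cone.  Since p is hyperbolic with respect to c too
   (Garding), in affine coordinates (s, y), with y in the direction of c and the
   line of l given by s = 0, the real branches y_i(s) of the curve have bounded
   slopes y_i'(s) near s = 0.  So the resultant disc(s) prod_i (1 + t y_i'(s))
   (up to sign), divided by the largest possible power of s, is a relation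
   between s and t = -1 / y_i' which does not vanish at (0, 0).  Eliminating the
   point of contact yields a real form which vanishes on all (complex) tangent
   lines but not at l, so l does not belong to the Zariski closure.
   Conversely, the cone generated by the real points is closed (Caratheodory), so
   a form l of the dual cone outside of it is separated from it by some point a.
   After a generic perturbation of a, all points of the curve on the line through
   e and a are smooth.  As l(a) < 0, the polynomial p(te - a) has a root t < 0, and
   the tangent at te - a is a real point of the dual curve which is positive at e
   and negative at a, a contradiction. *)
Require Import Defs.
From mathcomp Require Import boolp interval_inference topology normedtype.
From mathcomp Require Import perm separable fraction.
From mathcomp Require Import ring lra zify.
Import numFieldNormedType.Exports.
Import Order.TTheory GRing.Theory Num.Theory.
Set Implicit Arguments.
Unset Strict Implicit.
Unset Printing Implicit Defensive.
Local Open Scope classical_set_scope.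
Local Open Scope ring_scope.

(** * Roots of complex polynomials *)

(** The branches y_i(s) and the product formula for the resultant never appear, so no Puiseux
    expansion is involved. The slope bound is an inequality between two directional derivatives of p
    at the real points of the curve: where it fails, the derivative vanishes along some interior
    direction c + mu v of the cone but not along v. The non-vanishing at (0, 0) is a limit argument.
    For small real s > 0 all complex roots t of the relation have modulus at least a fixed delta, so
    all its coefficients in t are bounded by a multiple of the constant one ([coef_le_coef0]). After
    the division by the power of s some coefficient is nonzero at s = 0, and in the limit the
    constant one must be so too. The price of this division is that the relation says nothing about
    points of contact on the line s = 0, and the affine chart misses those at infinity. Both get
    factors of their own, which must not vanish at l either. The second inclusion depends on the
    first: forms that are non-negative on a neighborhood of e are bounded by their value at e, and
    this makes the generated cone closed. *)

Section RootEstimates.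
Variable C : numClosedFieldType.
Implicit Types (f A B : {poly C}) (F : {poly {poly C}}).

(** Induction over the linear factors X - z: such a factor multiplies the constant coefficient by
    |z| >= rho, and the bound on the weighted coefficients by at most 2 |z|. *)
Lemma coef_le_coef0 f (rho : C) : 0 < rho ->
  (forall z, root f z -> rho <= `|z|) ->
  forall k, `|f`_k| * rho ^+ k <= 2 ^+ (size f) * `|f`_0|.
Proof.
move=> rho0 hroots.
have [r fE] := closed_field_poly_normal f.
have [->|f0] := eqVneq f 0; first by move=> k; rewrite !coef0 normr0 mul0r mulr0.
have szr : (size r <= size f)%N.
  by rewrite [in size f]fE size_scale ?lead_coef_eq0 // size_prod_XsubC.
have hr : forall z, z \in r -> rho <= `|z|.
  by move=> z zr; apply: hroots; rewrite fE rootZ ?lead_coef_eq0 // root_prod_XsubC.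
have key : forall k, `|(\prod_(z <- r) ('X - z%:P))`_k| * rho ^+ k
    <= 2 ^+ (size r) * `|(\prod_(z <- r) ('X - z%:P))`_0|.
  elim: r hr {szr fE} => [|z r IH] hr k.
    rewrite big_nil !coef1 mul1r; case: k => [|k] //=.
      by rewrite normr1 expr0 mulr1.
    by rewrite normr0 mul0r normr1 ler01.
  rewrite big_cons; set g := \prod_(_ <- r) _ in IH *.
  have {}IH : forall k, `|g`_k| * rho ^+ k <= 2 ^+ size r * `|g`_0|.
    by apply: IH => y yr; apply: hr; rewrite inE yr orbT.
  have zr : rho <= `|z| by apply: hr; rewrite inE eqxx.
  rewrite !mulrBl !coefB !coefXM /= !coefCM sub0r normrN normrM.
  have b1 : `|z| * (`|g`_k| * rho ^+ k) <= `|z| * (2 ^+ size r * `|g`_0|).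
    by rewrite ler_wpM2l.
  have b2 : `|(if k == 0%N then 0 else g`_k.-1)| * rho ^+ k
     <= `|z| * (2 ^+ size r * `|g`_0|).
    case: k {b1} => [|k] /=.
      by rewrite normr0 mul0r !mulr_ge0 // exprn_ge0.
    rewrite exprS mulrCA; apply: ler_pM => //; first exact: ltW.
    by rewrite mulr_ge0 // exprn_ge0 // ltW.
  apply: le_trans (_ : (`|(if k == 0%N then 0 else g`_k.-1)| + `|z * g`_k|) * rho ^+ k <= _).
    by rewrite ler_wpM2r ?ler_normB // exprn_ge0 // ltW.
  rewrite mulrDl normrM -mulrA /= (exprS 2).
  have -> : 2 * 2 ^+ size r * (`|z| * `|g`_0|)
    = `|z| * (2 ^+ size r * `|g`_0|) + `|z| * (2 ^+ size r * `|g`_0|) by ring.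
  exact: lerD.
move=> k; set n := size f; rewrite fE !coefZ !normrM -mulrA [leRHS]mulrCA.
apply: ler_wpM2l => //; apply: (le_trans (key k)); rewrite ler_wpM2r //.
by rewrite ler_weXn2l // ler1n.
Qed.

Lemma horner_bounded f (M : C) : 0 <= M ->
  exists2 K, 0 < K & forall z, `|z| <= M -> `|f.[z]| <= K.
Proof.
move=> M0; elim/poly_ind: f => [|f c [K K0 hK]].
  by exists 1 => // z _; rewrite horner0 normr0 ler01.
exists (K * M + `|c| + 1); first by rewrite ltr_wpDl // addr_ge0 // mulr_ge0 // ltW.
move=> z zM; rewrite hornerMXaddC (le_trans (ler_normD _ _)) //.
rewrite -[leLHS]addr0 lerD // lerD // normrM ler_pM //; exact: hK.
Qed.

Lemma horner_cont f z0 (eta : C) : 0 < eta ->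
  exists2 delta, 0 < delta & forall z, `|z - z0| < delta -> `|f.[z] - f.[z0]| < eta.
Proof.
move=> eta0.
have /factor_theorem [g gE] : root (f - f.[z0]%:P) z0.
  by rewrite /root !hornerE subrr.
have [K K0 hK] := @horner_bounded g (`|z0| + 1) (addr_ge0 (normr_ge0 _) ler01).
have e0 : 0 < eta / K by rewrite divr_gt0.
have cmp : (eta / K) >=< (1 : C) by rewrite real_comparable // gtr0_real.
exists (Num.min (eta / K) 1); first by case: (comparable_leP cmp).
move=> z; rewrite comparable_lt_min // => /andP[z1 z2].
have -> : f.[z] - f.[z0] = g.[z] * (z - z0).
  by rewrite -[in RHS](hornerXsubC z0 z) -hornerM -gE !hornerE.
rewrite normrM.
apply: le_lt_trans (_ : K * `|z - z0| < _).
  rewrite ler_wpM2r // hK //.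
  by rewrite -[z in `|z|](subrKC z0) (le_trans (ler_normD _ _)) // lerD2l ltW.
by rewrite mulrC -ltr_pdivlMr.
Qed.

Lemma horner0_le A B (K delta : C) : 0 <= K -> 0 < delta ->
  (forall e, 0 < e < delta -> `|A.[e]| <= K * `|B.[e]|) ->
  `|A.[0]| <= K * `|B.[0]|.
Proof.
move=> K0 d0 h.
rewrite real_leNgt ?realM ?normr_real ?ger0_real //; apply/negP => lt.
set eta := (`|A.[0]| - K * `|B.[0]|) / (K + 1) / 2.
have K1 : 0 < K + 1 by rewrite ltr_wpDl.
have eta0 : 0 < eta by rewrite !divr_gt0 // subr_gt0.
have [d1 d10 h1] := @horner_cont A 0 _ eta0.
have [d2 d20 h2] := @horner_cont B 0 _ eta0.
pose dl := (Num.min delta (Num.min d1 d2)).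
have c12 : d1 >=< d2 by rewrite real_comparable // gtr0_real.
have m0 : 0 < Num.min d1 d2 by case: (comparable_leP c12).
have c3 : delta >=< Num.min d1 d2 by rewrite real_comparable // gtr0_real.
have dl0 : 0 < dl by rewrite /dl; case: (comparable_leP c3).
pose e := dl / 2.
have e0 : 0 < e by rewrite divr_gt0.
have edl : e < dl by rewrite ltr_pdivrMr // ltr_pMr // ltr1n.
move: (edl); rewrite /dl comparable_lt_min // => /andP[ed].
rewrite comparable_lt_min // => /andP[ed1 ed2].
have ne : `|e - 0| = e by rewrite subr0 gtr0_norm.
have := h1 e; rewrite ne => /(_ ed1) hA.
have := h2 e; rewrite ne => /(_ ed2) hB.
have := h e; rewrite e0 ed => /(_ isT) hh.
have : `|A.[0]| < K * `|B.[0]| + (K + 1) * eta.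
  have -> : A.[0] = A.[e] - (A.[e] - A.[0]) by ring.
  apply: le_lt_trans (ler_normB _ _) _.
  have -> : K * `|B.[0]| + (K + 1) * eta = K * (`|B.[0]| + eta) + eta by ring.
  apply: ler_ltD => //; apply: le_trans hh _; rewrite ler_wpM2l //.
  have -> : B.[e] = B.[0] + (B.[e] - B.[0]) by ring.
  by rewrite (le_trans (ler_normD _ _)) // lerD2l ltW.
have -> : (K + 1) * eta = (`|A.[0]| - K * `|B.[0]|) / 2.
  by rewrite /eta; field; rewrite gt_eqF.
rewrite -ltrBlDl.
rewrite ltr_pdivlMr // mulr_natr => hlt.
suff /(lt_trans hlt) : `|A.[0]| - K * `|B.[0]| < (`|A.[0]| - K * `|B.[0]|) *+ 2.
  by rewrite ltxx.
by rewrite mulr2n ltrDl subr_gt0.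
Qed.

(** |f(t)| is the modulus of the leading coefficient times the product of the distances from t to
    the roots. *)
Lemma norm_horner_ge f (t m : C) : f != 0 -> 0 <= m ->
  (forall z, root f z -> m <= `|t - z|) ->
  `|lead_coef f| * m ^+ (size f).-1 <= `|f.[t]|.
Proof.
move=> f0 m0 hz.
have [r fE] := closed_field_poly_normal f.
have hr : forall z, z \in r -> m <= `|t - z|.
  by move=> z zr; apply: hz; rewrite fE rootZ ?lead_coef_eq0 // root_prod_XsubC.
have -> : (size f).-1 = size r.
  by rewrite [in size f]fE size_scale ?lead_coef_eq0 // size_prod_XsubC.
rewrite [in leRHS]fE hornerZ normrM ler_wpM2l //.
elim: r hr {fE} => [|z r IH] hr.
  by rewrite big_nil expr0 hornerE normr1.
rewrite big_cons hornerM normrM exprS hornerXsubC ler_pM //.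
- by rewrite exprn_ge0.
- by apply: hr; rewrite inE eqxx.
- by apply: IH => y yr; apply: hr; rewrite inE yr orbT.
Qed.

Lemma root_close f (t m : C) : f != 0 -> 0 < m ->
  `|f.[t]| < `|lead_coef f| * m ^+ (size f).-1 ->
  exists2 z, root f z & `|t - z| < m.
Proof.
move=> f0 m0 lt; apply: contrapT => h.
suff : `|lead_coef f| * m ^+ (size f).-1 <= `|f.[t]| by rewrite (lt_geF lt).
apply: norm_horner_ge => // [|z rz]; first exact: ltW.
rewrite real_leNgt ?(gtr0_real m0) ?normr_real //.
by apply/negP => zl; apply: h; exists z.
Qed.

Section RootContinuity.
Variables (F : {poly {poly C}}) (d : nat) (c : C).
Hypotheses (szF : (size F <= d.+1)%N) (lcF : F`_d = c%:P) (c0 : c != 0).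
Let Fs s := map_poly (horner_eval s) F.

Let Fsd s : (Fs s)`_d = c.
Proof. by rewrite coef_map lcF /= /horner_eval hornerC. Qed.
Let szFs s : size (Fs s) = d.+1.
Proof.
apply/eqP; rewrite eqn_leq (leq_trans (size_poly _ _)) //= ltnNge; apply/negP => h.
by move: c0; rewrite -(Fsd s) nth_default // eqxx.
Qed.
Let lcFs s : lead_coef (Fs s) = c.
Proof. by rewrite lead_coefE szFs Fsd. Qed.
Let Fs0 s : Fs s != 0.
Proof. by rewrite -size_poly_eq0 szFs. Qed.

(** The leading coefficient c does not depend on s, so the degree of the fibers never drops, and a
    small value at t0 forces a root near t0. *)
Lemma root_lower_cont s0 t0 (eps : C) : 0 < eps -> root (Fs s0) t0 ->
  exists2 delta, 0 < delta &
    forall s, `|s - s0| < delta -> exists2 t, root (Fs s) t & `|t0 - t| < eps.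
Proof.
move=> e0 rt.
have FsE s : (Fs s).[t0] = (F.[t0%:P]).[s].
  by have := horner_map (horner_eval s) F t0%:P; rewrite /= {2 3}/horner_eval hornerC.
have gt0 : 0 < `|c| * eps ^+ d by rewrite mulr_gt0 ?normr_gt0 ?exprn_gt0.
have [delta d0 hd] := @horner_cont F.[t0%:P] s0 _ gt0.
exists delta => // s /hd; rewrite -!FsE (rootP rt) subr0 => h.
by apply: root_close; rewrite // szFs lcFs.
Qed.

(** If t is far from all roots at s0, the value at t of the polynomial at s0 is at least |c| (kap (1
    + |t|))^d. It is also the difference of the values for s0 and s, hence small compared to (1 +
    |t|)^d. The weight 1 + |t| makes the estimate uniform in t. *)
Lemma root_upper_cont s0 (eps : C) : 0 < eps ->
  exists2 delta, 0 < delta & forall s t, `|s - s0| < delta -> root (Fs s) t ->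
    exists2 t0, root (Fs s0) t0 & `|t - t0| < eps.
Proof.
move=> e0.
have [M M0 hM] : exists2 M, 0 <= M & forall z, root (Fs s0) z -> `|z| <= M.
  have [r fE] := closed_field_poly_normal (Fs s0).
  exists (\sum_(z <- r) `|z|); first by rewrite sumr_ge0.
  move=> z; rewrite fE rootZ ?lead_coef_eq0 // root_prod_XsubC => zr.
  by rewrite (big_rem z) //= lerDl sumr_ge0.
(* Chosen such that eps <= |t - z| and |z| <= M imply kap (1 + |t|) <= |t - z|. *)
pose kap := eps / (1 + eps + M).
have den0 : 0 < 1 + eps + M by rewrite ltr_wpDr // addr_gt0.
have kap0 : 0 < kap by rewrite divr_gt0.
(* The d lower coefficients contribute at most d eta (1 + |t|)^d; the denominator d + 1 makes this
   too small, also for d = 0. *)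
pose eta := `|c| * kap ^+ d / d.+1%:R.
have eta0 : 0 < eta by rewrite divr_gt0 ?ltr0Sn // mulr_gt0 ?normr_gt0 ?exprn_gt0.
have [delta d0 hd] : exists2 delta, 0 < delta & forall s, `|s - s0| < delta ->
    forall k, (k < d)%N -> `|(Fs s0)`_k - (Fs s)`_k| < eta.
  elim: d => [|k [d1 d10 h1]]; first by exists 1.
  have [d2 d20 h2] := @horner_cont F`_k s0 _ eta0.
  have c12 : d1 >=< d2 by rewrite real_comparable // gtr0_real.
  exists (Num.min d1 d2); first by case: (comparable_leP c12).
  move=> s; rewrite comparable_lt_min // => /andP[s1 s2] j.
  rewrite ltnS leq_eqVlt => /orP[/eqP ->|]; last exact: h1.
  by rewrite !coef_map /= /horner_eval distrC; apply: h2.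
exists delta => // s t sd rt.
apply: contrapT => h.
have hz z : root (Fs s0) z -> kap * (1 + `|t|) <= `|t - z|.
  move=> rz; have ez : eps <= `|t - z|.
    rewrite real_leNgt ?(gtr0_real e0) ?normr_real //.
    by apply/negP => zl; apply: h; exists z.
  rewrite /kap mulrAC ler_pdivrMr // [leRHS]mulrDr.
  have -> : eps * (1 + `|t|) = eps + eps * `|t| by ring.
  apply: le_trans (_ : eps + eps * (`|t - z| + M) <= _).
    rewrite lerD2l ler_wpM2l ?(ltW e0) // -[t in `|t|](subrK z).
    by rewrite (le_trans (ler_normD _ _)) // lerD2l hM.
  have -> : eps + eps * (`|t - z| + M) = eps * (1 + M) + `|t - z| * eps by ring.
  have -> : `|t - z| * (1 + eps) + `|t - z| * M = `|t - z| * (1 + M) + `|t - z| * eps by ring.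
  by rewrite lerD2r ler_wpM2r // addr_ge0.
have t1 : 0 <= 1 + `|t| by rewrite addr_ge0.
have := @norm_horner_ge (Fs s0) t (kap * (1 + `|t|)) (Fs0 s0) (mulr_ge0 (ltW kap0) t1) hz.
rewrite lcFs szFs /= => lb.
have ub : `|(Fs s0).[t]| <= \sum_(k < d) eta * (1 + `|t|) ^+ d.
  have -> : (Fs s0).[t] = \sum_(k < d) ((Fs s0)`_k - (Fs s)`_k) * t ^+ k.
    rewrite -[LHS]subr0 -[X in _ - X](rootP rt) !horner_coef !szFs -sumrB.
    rewrite big_ord_recr /= !Fsd subrr addr0.
    by apply: eq_bigr => k _; rewrite mulrBl.
  apply: le_trans (ler_norm_sum _ _ _) _; apply: ler_sum => k _.
  rewrite normrM normrX ler_pM ?exprn_ge0 //; first by rewrite ltW // hd.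
  apply: le_trans (_ : (1 + `|t|) ^+ k <= _).
    by rewrite lerXn2r ?nnegrE // lerDr.
  by rewrite ler_weXn2l ?lerDl // ltnW.
have := le_trans lb ub; rewrite sumr_const card_ord exprMn mulrA -mulrnAl.
have p0 : 0 < (1 + `|t|) ^+ d by rewrite exprn_gt0 // ltr_pwDl.
rewrite ler_pM2r // /eta -mulr_natr -mulrA -[leLHS]mulr1 ler_pM2l; last first.
  by rewrite mulr_gt0 ?normr_gt0 ?exprn_gt0.
by rewrite mulrC ler_pdivlMr ?ltr0Sn // mul1r ler_nat ltnn.
Qed.

End RootContinuity.
End RootEstimates.

(** * Substitution in multivariate polynomials *)

Section Substitution.
Variables (R : comNzRingType) (n : nat).
Implicit Types f g : {mpoly R[n]}.

Lemma mmap_morph (S T : comNzRingType) (psi : {rmorphism S -> T})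
    (iS : {rmorphism R -> S}) (iT : {rmorphism R -> T}) hS hT f :
  (forall c, psi (iS c) = iT c) -> (forall i, psi (hS i) = hT i) ->
  psi (mmap iS hS f) = mmap iT hT f.
Proof.
move=> hi hh; rewrite /mmap rmorph_sum; apply: eq_bigr => m _.
rewrite rmorphM hi; congr (_ * _); rewrite /mmap1 rmorph_prod.
by apply: eq_bigr => i _; rewrite rmorphXn hh.
Qed.

Lemma eq_mmap (S : comNzRingType) (iS iS' : {rmorphism R -> S}) h h' f :
  iS =1 iS' -> h =1 h' -> mmap iS h f = mmap iS' h' f.
Proof. exact: (@mmap_morph S S idfun). Qed.

Lemma mmap_homogZ (S : comNzRingType) (iS : {rmorphism R -> S}) d k h f :
  f \is d.-homog -> mmap iS (fun i => k * h i) f = k ^+ d * mmap iS h f.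
Proof.
move=> /dhomogP hf; rewrite /mmap mulr_sumr !big_seq; apply: eq_bigr => m mf.
rewrite mulrCA; congr (_ * _); rewrite /mmap1; have <- : mdeg m = d := hf _ mf.
rewrite mdegE -prodrXr.
by rewrite -big_split; apply: eq_bigr => i _; rewrite exprMn.
Qed.

(** A size bound together with the coefficient in that degree is multiplicative even when the
    coefficient is zero, in contrast to the leading coefficient. So it suffices to look at the
    linear factors u + v X of each monomial. *)
Lemma mmap_linear_coef (S : comNzRingType) (iS : {rmorphism R -> S}) d u v f :
  f \is d.-homog ->
  let F := mmap (polyC \o iS) (fun i => (u i)%:P + (v i)%:P * 'X) f in
  (size F <= d.+1)%N /\ F`_d = mmap iS v f.
Proof.
pose ok k (P : {poly S}) a := (size P <= k.+1)%N /\ P`_k = a.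
have okM j k P Q a b : ok j P a -> ok k Q b -> ok (j + k)%N (P * Q) (a * b).
  move=> [sP Pa] [sQ Qb]; split.
    have := leq_add sP sQ; have := size_polyMleq P Q; lia.
  rewrite coefM (bigD1 (inord j)) //= inordK ?ltnS ?leq_addr // addKn Pa Qb.
  rewrite big1 ?addr0 // => i.
  rewrite -(inj_eq val_inj) /= inordK ?ltnS ?leq_addr // neq_ltn => /orP[ij|ij].
    by rewrite [Q`__]nth_default ?mulr0 // (leq_trans sQ) //; lia.
  by rewrite [P`__]nth_default ?mul0r // (leq_trans sP).
have okX k j P a : ok k P a -> ok (j * k)%N (P ^+ j) (a ^+ j).
  move=> h; elim: j => [|j IH]; first by split; rewrite ?expr0 ?size_poly1 // coef1.
  by rewrite !exprS mulSn; apply: okM.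
move=> /dhomogP hf /=; suff : ok d (mmap (polyC \o iS) (fun i => (u i)%:P + (v i)%:P * 'X) f)
  (mmap iS v f) by [].
rewrite /mmap !big_seq.
elim/big_ind2 : _ => [|P a Q b [sP Pa] [sQ Qb]|m mf].
- by split; rewrite ?size_poly0 ?coef0.
- split; first by rewrite (leq_trans (size_polyD _ _)) // geq_max sP.
  by rewrite coefD Pa Qb.
- rewrite -[d]add0n; apply: (okM).
    by split; rewrite /= ?size_polyC ?leq_b1 // coefC.
  have <- : mdeg m = d := hf _ mf; rewrite mdegE /mmap1.
  elim/big_ind3 : _ => [|k P a j Q b|i _]; first by split; rewrite ?size_poly1 ?coef1.
    exact: okM.
  rewrite -[X in ok X]muln1; apply: okX; split.
    apply: leq_trans (size_polyD _ _) _; rewrite geq_max (leq_trans (size_polyC_leq1 _)) //=.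
    by rewrite (leq_trans (size_polyMleq _ _)) // size_polyX addn2 /= ltnS size_polyC_leq1.
  by rewrite coefD coefC /= add0r coefCM coefX mulr1.
Qed.

Lemma deriv_mmap (S : comNzRingType) (iS : {rmorphism R -> S}) (h : 'I_n -> {poly S}) f :
  (mmap (polyC \o iS) h f)^`() =
  \sum_(i < n) mmap (polyC \o iS) h f^`M(i) * (h i)^`().
Proof.
pose ok (f : {mpoly R[n]}) := (mmap (polyC \o iS) h f)^`() =
  \sum_(i < n) mmap (polyC \o iS) h f^`M(i) * (h i)^`().
rewrite -/(ok f).
have okM f1 g : ok f1 -> ok g -> ok (f1 * g).
  rewrite /ok => hf hg; rewrite rmorphM derivM hf hg mulr_suml mulr_sumr -big_split.
  by apply: eq_bigr => i _; rewrite mderivM rmorphD !rmorphM /=; ring.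
have okC c : ok c%:MP.
  rewrite /ok mmapC /= derivC big1 // => i _.
  by rewrite mderivC mmap0 mul0r.
have okX i : ok 'X_i.
  have U0 : (U_(i) - U_(i) = 0)%MM by apply/mnmP => j; rewrite mnmBE subnn mnm0E.
  rewrite /ok mmapX (bigD1 i) //= mderivX mnm1E eqxx scale1r U0 mpolyX0 mmap1U.
  rewrite rmorph1 mul1r big1 ?addr0 // => j ji.
  by rewrite mderivX mnm1E eq_sym (negPf ji) scale0r mmap0 mul0r.
have okXm m : ok 'X_[m].
  rewrite mpolyXE_id; elim/big_ind : _ => // [|i _]; first exact: (okC 1).
  by elim: (m i) => [|k IH]; rewrite ?expr0 ?exprS; [exact: (okC 1)|exact: okM].
elim/mpolyind : f => [|c m f _ _ IH].
  by rewrite -mpolyC0; exact: okC.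
rewrite -mul_mpolyC /ok rmorphD derivD IH (okM _ _ (okC c) (okXm m)) -big_split.
by apply: eq_bigr => i _; rewrite mderivD rmorphD /= mulrDl.
Qed.

End Substitution.

Lemma irreducible_homog_pos (R : realType) n (p : {mpoly R[n]}) d :
  irreducible_mpoly p -> p \is d.-homog -> (0 < d)%N.
Proof.
move=> [p0 /negP nu _] hp; rewrite lt0n; apply/eqP => d0; apply: nu.
have [c c0 ->] : exists2 c, c != 0 & p = c%:MP.
  apply/msize_poly1P; rewrite eqn_leq lt0n msize_poly_eq0 p0 andbT msizeE.
  by apply/bigmax_leqP_seq => m mf _; have /dhomogP/(_ m mf) := hp; rewrite d0 => /= ->.
by rewrite rmorph_unit // unitfE.
Qed.

(** * Evaluation at complex points and restriction to lines *)

Local Notation cvec v := (map_mx (real_complex _) v).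

Section Evaluation.
Variables (R : realType) (n : nat).
Local Notation C := R[i].
Local Notation rc := (real_complex R).
Implicit Types (f : {mpoly R[n]}) (x u v w : 'rV[C]_n).

Definition dirder f x v : C := \sum_(i < n) ceval f^`M(i) x * v 0 i.

Definition dirpoly f (v : 'rV[R]_n) : {mpoly R[n]} := \sum_(i < n) v 0 i *: f^`M(i).

Definition cline f u v : {poly C} :=
  mmap (polyC \o rc) (fun i => (u 0 i)%:P + (v 0 i)%:P * 'X) f.

Lemma ceval_mmap f x : ceval f x = mmap rc (x 0) f.
Proof.
rewrite /ceval /map_mpoly /meval; apply: mmap_morph => [c|i] /=.
  by rewrite mmapC.
by rewrite mmapX mmap1U.
Qed.

Lemma ceval_real f (a : 'rV[R]_n) : ceval f (cvec a) = rc f.@[a 0].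
Proof. by rewrite ceval_mmap; apply/esym/mmap_morph => // i; rewrite mxE. Qed.

Lemma ceval_mmapE f x (h : 'I_n -> C) : (forall i, x 0 i = h i) -> ceval f x = mmap rc h f.
Proof. by move=> hx; rewrite ceval_mmap; apply: eq_mmap. Qed.

Lemma horner_cline f u v t : (cline f u v).[t] = ceval f (u + t *: v).
Proof.
rewrite ceval_mmap -horner_evalE; apply: mmap_morph => [c|i].
  by rewrite /= /horner_eval hornerC.
by rewrite /= /horner_eval !hornerE !mxE mulrC.
Qed.

Lemma horner_deriv_cline f u v t :
  (cline f u v)^`().[t] = dirder f (u + t *: v) v.
Proof.
rewrite deriv_mmap horner_sum; apply: eq_bigr => i _.
have -> : ((u 0 i)%:P + (v 0 i)%:P * 'X)^`() = (v 0 i)%:P.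
  by rewrite derivD derivM !derivC derivX mul0r !add0r mulr1.
by rewrite hornerM hornerC -horner_cline.
Qed.

Lemma cline_coef d f u v : f \is d.-homog ->
  (size (cline f u v) <= d.+1)%N /\ (cline f u v)`_d = ceval f v.
Proof.
move=> hf; have [-> ->] := mmap_linear_coef rc (u 0) (v 0) hf.
by rewrite ceval_mmap.
Qed.

Lemma ceval_homogZ d f k x : f \is d.-homog -> ceval f (k *: x) = k ^+ d * ceval f x.
Proof.
move=> hf; rewrite (@ceval_mmapE _ _ (fun i => k * x 0 i)) => [|i]; last by rewrite mxE.
by rewrite (mmap_homogZ _ _ _ hf) ceval_mmap.
Qed.

Lemma ceval_dirpoly f (v : 'rV[R]_n) x : ceval (dirpoly f v) x = dirder f x (cvec v).
Proof.
rewrite ceval_mmap rmorph_sum; apply: eq_bigr => i _.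
by rewrite /= mmapZ mxE -ceval_mmap mulrC.
Qed.

Lemma dirderD f x u v : dirder f x (u + v) = dirder f x u + dirder f x v.
Proof. by rewrite -big_split; apply: eq_bigr => i _; rewrite mxE mulrDr. Qed.

Lemma dirderZ f x k v : dirder f x (k *: v) = k * dirder f x v.
Proof. by rewrite mulr_sumr; apply: eq_bigr => i _; rewrite mxE mulrCA. Qed.

Lemma dirder_real f (a v : 'rV[R]_n) : dirder f (cvec a) (cvec v) = rc (dirpoly f v).@[a 0].
Proof. by rewrite -ceval_dirpoly ceval_real. Qed.

Lemma euler d f x : f \is d.-homog -> dirder f x x = d%:R * ceval f x.
Proof.
move=> hf; have <- : (cline f 0 x)^`().[1] = dirder f x x.
  by rewrite horner_deriv_cline add0r scale1r.
have -> : cline f 0 x = ceval f x *: 'X^d.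
  rewrite /cline (@eq_mmap _ _ _ _ (polyC \o rc) _ (fun i => 'X * (x 0 i)%:P)) //; last first.
    by move=> i; rewrite mxE add0r mulrC.
  rewrite (mmap_homogZ _ _ _ hf) mulrC -mul_polyC; congr (_ * _).
  by rewrite ceval_mmap; apply/esym/mmap_morph.
by rewrite derivZ derivXn hornerZ hornerMn hornerXn expr1n mulrC.
Qed.

(** f(u + s w + t v) with t as outer and s as inner variable. For homogeneous f its top coefficient
    f(v) is free of s, as the continuity of roots demands. *)
Definition cfam f u w v : {poly {poly C}} :=
  mmap (polyC \o (polyC \o rc))
    (fun i => ((u 0 i)%:P + (w 0 i)%:P * 'X)%:P + (v 0 i)%:P%:P * 'X) f.

Lemma cfam_eval f u w v s :
  map_poly (horner_eval s) (cfam f u w v) = cline f (u + s *: w) v.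
Proof.
apply: mmap_morph => [c|i] /=.
  by rewrite map_polyC /= /horner_eval hornerC.
by rewrite rmorphD rmorphM /= !map_polyC map_polyX /= /horner_eval !hornerE !mxE mulrC.
Qed.

Lemma cfam_coef d f u w v : f \is d.-homog ->
  (size (cfam f u w v) <= d.+1)%N /\ (cfam f u w v)`_d = (ceval f v)%:P.
Proof.
move=> hf; have [-> ->] := mmap_linear_coef (polyC \o rc)
  (fun i => (u 0 i)%:P + (w 0 i)%:P * 'X) (fun i => (v 0 i)%:P) hf.
split=> //; rewrite ceval_mmap; apply/esym; exact: mmap_morph.
Qed.

Lemma ceval_root_lower d f u w v s0 t0 (eps : C) : f \is d.-homog ->
  ceval f v != 0 -> 0 < eps -> ceval f (u + s0 *: w + t0 *: v) = 0 ->
  exists2 delta, 0 < delta & forall s, `|s - s0| < delta ->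
    exists2 t, ceval f (u + s *: w + t *: v) = 0 & `|t0 - t| < eps.
Proof.
move=> hf fv e0 h; have [sz lc] := cfam_coef u w v hf.
have [|delta d0 hd] := root_lower_cont sz lc fv (s0 := s0) (t0 := t0) e0.
  by rewrite cfam_eval; apply/rootP; rewrite horner_cline.
exists delta => // s /hd[t]; rewrite cfam_eval => /rootP.
by rewrite horner_cline; exists t.
Qed.

Lemma ceval_root_upper d f u w v s0 (eps : C) : f \is d.-homog ->
  ceval f v != 0 -> 0 < eps ->
  exists2 delta, 0 < delta & forall s t, `|s - s0| < delta ->
    ceval f (u + s *: w + t *: v) = 0 ->
    exists2 t0, ceval f (u + s0 *: w + t0 *: v) = 0 & `|t - t0| < eps.
Proof.
move=> hf fv e0; have [sz lc] := cfam_coef u w v hf.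
have [delta d0 hd] := root_upper_cont sz lc fv s0 e0.
exists delta => // s t sd h.
have [|t0] := hd s t sd.
  by rewrite cfam_eval; apply/rootP; rewrite horner_cline.
by rewrite cfam_eval => /rootP; rewrite horner_cline; exists t0.
Qed.

Lemma line_rootE f (e a : 'rV[R]_n) z :
  line_root f e a z <-> ceval f (z *: cvec e - cvec a) = 0.
Proof.
rewrite /line_root.
suff -> : map_poly rc (restrict_line f e a) = cline f (- cvec a) (cvec e).
  by split=> [/rootP|h]; [|apply/rootP]; rewrite horner_cline addrC.
apply: mmap_morph => [c|i] /=; first by rewrite map_polyC.
rewrite rmorphB /= linearZ /= map_polyC map_polyX /= !mxE polyCN addrC.
by rewrite -mul_polyC.
Qed.

End Evaluation.

Section ComplexNumbers.
Variable R : realType.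
Local Notation C := R[i].
Local Notation rc := (real_complex R).

Lemma normc_ge_Im (z : C) : rc `|complex.Im z| <= `|z|.
Proof.
have := normc_ge_Re (z * 'i%C); rewrite ReiNIm normrN normrM.
by rewrite [`|'i%C|]normc_def /= expr0n expr1n add0r sqrtr1 mulr1.
Qed.

Lemma norm_rc (r : R) : `|rc r| = rc `|r|.
Proof. by rewrite normc_def /= expr0n addr0 sqrtr_sqr. Qed.

Lemma rc_gt0 (r : R) : (0 < rc r) = (0 < r).
Proof. exact: (ltcR 0 r). Qed.

Lemma rc_eq0 (r : R) : (rc r == 0) = (r == 0).
Proof. exact: (inj_eq (@complexI R) r 0). Qed.

Lemma half_lt (r : R) : 0 < r -> r / 2 < r.
Proof. by move=> r0; rewrite ltr_pdivrMr // ltr_pMr // ltr1n. Qed.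

Lemma gt0_complexP (z : C) : 0 < z -> exists2 r : R, 0 < r & z = rc r.
Proof.
move=> z0; have /complex_realP[k zk] : z \is Num.real by rewrite gtr0_real.
by exists k => //; move: z0; rewrite zk ltcR.
Qed.

Lemma root_lbound (f : {poly C}) (g : C -> R) : f != 0 ->
  (forall z, root f z -> 0 < g z) ->
  exists2 eps : R, 0 < eps & forall z, root f z -> eps <= g z.
Proof.
move=> f0 hz; have [r fE] := closed_field_poly_normal f.
have rE z : root f z = (z \in r).
  by rewrite fE rootZ ?lead_coef_eq0 // root_prod_XsubC.
have {hz} hz z : z \in r -> 0 < g z by rewrite -rE; exact: hz.
suff [eps e0 he] : exists2 eps : R, 0 < eps & forall z, z \in r -> eps <= g z.
  by exists eps => // z; rewrite rE; exact: he.
elim: r hz {fE rE} => [|y r IH] hz; first by exists 1.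
have [|eps e0 he] := IH; first by move=> z zr; apply: hz; rewrite inE zr orbT.
exists (Num.min eps (g y)); first by rewrite lt_min e0 hz ?inE ?eqxx.
by move=> z; rewrite inE ge_min => /orP[/eqP->|/he ->//]; rewrite lexx orbT.
Qed.

End ComplexNumbers.

(** * Hyperbolic polynomials *)

Section Hyperbolicity.
Variables (R : realType) (n : nat) (p : {mpoly R[n]}) (d : nat) (e : 'rV[R]_n).
Local Notation C := R[i].
Local Notation rc := (real_complex R).
Local Notation ii := ('i%C : C).
Hypothesis p_homog : p \is d.-homog.
Hypothesis pe0 : ceval p (cvec e) != 0.
Hypothesis p_real : forall (a : 'rV[R]_n) (z : C),
  ceval p (z *: cvec e - cvec a) = 0 -> z \is Num.real.

(* The interior of the hyperbolicity cone: the roots of p(te - c) are positive. *)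
Definition inner_cone (c : 'rV[R]_n) : Prop :=
  forall z : C, ceval p (z *: cvec e - cvec c) = 0 -> 0 < z.

Lemma inner_cone_base : inner_cone e.
Proof.
move=> z; rewrite -{2}[cvec e]scale1r -scalerBl (ceval_homogZ _ _ p_homog).
move/eqP; rewrite mulf_eq0 (negPf pe0) orbF expf_eq0 subr_eq0 => /andP[_ /eqP->].
exact: ltr01.
Qed.

Lemma ceval_homogN x : ceval p (- x) = (-1) ^+ d * ceval p x.
Proof. by rewrite -scaleN1r (ceval_homogZ _ _ p_homog). Qed.

Lemma inner_cone_neq0 c : inner_cone c -> ceval p (cvec c) != 0.
Proof.
move=> hc; apply/eqP => h.
have := hc 0; rewrite scale0r add0r ceval_homogN h mulr0 => /(_ erefl).
by rewrite ltxx.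
Qed.

Lemma no_real_zero a (alpha : R) : alpha != 0 ->
  ceval p (cvec a + (rc alpha * ii) *: cvec e) <> 0.
Proof.
move=> al0 h; have /p_real : ceval p ((rc alpha * ii) *: cvec e - cvec (- a)) = 0.
  by rewrite map_mxN opprK addrC.
have -> : rc alpha * ii = Complex 0 alpha.
  by apply/eqP; rewrite eq_complex /= !mulr0 !mul0r mulr1 subr0 addr0 !eqxx.
by rewrite complex_real (negPf al0).
Qed.

(** By homogeneity - i alpha / t is a root of p(z e - c), hence a real r > 0, and t = - i alpha / r.
    This is the starting point s = 0 of the homotopy below. *)
Lemma inner_cone_base_line c (alpha : R) (t : C) : inner_cone c -> 0 < alpha ->
  ceval p ((rc alpha * ii) *: cvec e + t *: cvec c) = 0 -> complex.Im t < 0.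
Proof.
move=> hc al0 h.
have t0 : t != 0.
  apply/eqP => t0; apply: (@no_real_zero 0 alpha); first by rewrite gt_eqF.
  by rewrite map_mx0 add0r -h t0 scale0r addr0.
have [] := gt0_complexP (hc (- (rc alpha * ii) / t) _).
  have -> : (- (rc alpha * ii) / t) *: cvec e - cvec c =
    (- t^-1) *: ((rc alpha * ii) *: cvec e + t *: cvec c).
    rewrite scalerDr !scalerA.
    have -> : - t^-1 * t = -1 by rewrite mulNr mulVf.
    by rewrite scaleN1r; congr (_ *: _ - _); ring.
  by rewrite (ceval_homogZ _ _ p_homog) h mulr0.
move=> r r0 rE.
have rc0 : rc r != 0 by rewrite rc_eq0 gt_eqF.
have -> : t = rc (- (alpha / r)) * ii.
  have <- : - (rc alpha * ii) / rc r = t.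
    by apply: (canLR (mulfK rc0)); rewrite -rE mulrCA mulfV // mulr1.
  by rewrite rmorphN rmorphM fmorphV /=; field.
by rewrite /= mulr1 mul0r addr0 oppr_lt0 divr_gt0.
Qed.

(* As s decreases from 1 to 0, the roots t of p(i alpha e + s a + t c) cannot cross
   the real axis, by hyperbolicity with respect to e; at s = 0 they are all in the
   lower half plane. *)
Lemma homotopy_Im a c (alpha : R) (t : C) : inner_cone c -> 0 < alpha ->
  ceval p ((rc alpha * ii) *: cvec e + cvec a + t *: cvec c) = 0 ->
  complex.Im t < 0.
Proof.
move=> hc al0 h1; rewrite ltNge; apply/negP => It.
pose P (s : R) (t : C) :=
  ceval p ((rc alpha * ii) *: cvec e + rc s *: cvec a + t *: cvec c) = 0.
have pc0 := inner_cone_neq0 hc.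
have ImN0 s t' : P s t' -> complex.Im t' != 0.
  move=> h; apply/eqP => I0.
  have al0' : alpha != 0 by rewrite gt_eqF.
  apply: (@no_real_zero (s *: a + complex.Re t' *: c) alpha al0').
  have tE : t' = rc (complex.Re t') by case: t' I0 {h} => x y /= ->.
  have -> : cvec (s *: a + complex.Re t' *: c) =
      rc s *: cvec a + rc (complex.Re t') *: cvec c by rewrite map_mxD !map_mxZ.
  by rewrite -tE addrC addrA.
pose E := [set s : R | 0 <= s <= 1 /\ exists2 t, P s t & 0 < complex.Im t].
have E1 : E 1.
  split; first by rewrite ler01 lexx.
  have h : P 1 t by rewrite /P rmorph1 scale1r.
  by exists t => //; rewrite lt_def (ImN0 1).
have E0 s : E s -> s != 0.
  move=> [_ [t' h]]; apply: contraTneq => s0; move: h; rewrite s0 => h; rewrite -leNgt; apply: ltW.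
  apply: (inner_cone_base_line hc al0); rewrite -h rmorph0 scale0r addr0 //.
have hinf : has_inf E.
  by split; [exists 1|exists 0 => s [/andP[]]].
pose s0 := inf E.
have s0ge : 0 <= s0 by apply: lb_le_inf => [|s [/andP[]]//]; exists 1.
have s0le : s0 <= 1 := ge_inf hinf.2 E1.
(* If the infimum s0 is attained, the root persists for slightly smaller s, since s0 > 0. If not,
   all roots at s0 lie below the real axis by some fixed margin, and roots for nearby s cannot be
   above it. *)
have [[t0 h0 It0]|none] := pselect (exists2 t, P s0 t & 0 < complex.Im t).
  have s0gt : 0 < s0.
    rewrite lt_def s0ge andbT; apply: E0.
    by split; [rewrite s0ge s0le|exists t0].
  have I0 : 0 < rc (complex.Im t0) by rewrite rc_gt0.
  have [delta /gt0_complexP[dl dl0 ->] hd] := ceval_root_lower p_homog pc0 I0 h0.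
  pose s := s0 - Num.min s0 (dl / 2).
  have m0 : 0 < Num.min s0 (dl / 2) by rewrite lt_min s0gt divr_gt0.
  have ss0 : s < s0 by rewrite ltrBlDr ltrDl.
  have [] := hd (rc s).
    have -> : rc s - rc s0 = rc (- Num.min s0 (dl / 2)).
      by rewrite -rmorphB /s addrAC subrr add0r.
    by rewrite norm_rc ltcR normrN (gtr0_norm m0) gt_min (half_lt dl0) orbT.
  move=> t' h' tt.
  suff : E s by move/(ge_inf hinf.2); rewrite leNgt ss0.
  split.
    rewrite subr_ge0 ge_min lexx /=; exact: le_trans (ltW ss0) s0le.
  exists t' => //; have := le_lt_trans (normc_ge_Im (t0 - t')) tt.
  rewrite ltcR raddfB /= => /ltr_normlW; lra.
have neg z : root (cline p ((rc alpha * ii) *: cvec e + rc s0 *: cvec a) (cvec c)) z ->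
    0 < - complex.Im z.
  move=> /rootP; rewrite horner_cline => hz; rewrite oppr_gt0 lt_def eq_sym (ImN0 s0) //=.
  by rewrite leNgt; apply/negP => I0; apply: none; exists z.
have [|eps eps0 heps] := root_lbound _ neg.
  apply/eqP => h0; move: pc0; have [_ <-] := cline_coef
    ((rc alpha * ii) *: cvec e + rc s0 *: cvec a) (cvec c) p_homog.
  by rewrite h0 coef0 eqxx.
have ceps0 : 0 < rc eps by rewrite rc_gt0.
have [delta /gt0_complexP[dl dl0 ->] hd] := ceval_root_upper
  ((rc alpha * ii) *: cvec e) (cvec a) (rc s0) p_homog pc0 ceps0.
have [s Es sl] := inf_adherent dl0 hinf.
have s0s : s0 <= s := ge_inf hinf.2 Es.
case: Es => _ [t' ht' It'].
have [|t0 ht0 tt] := hd (rc s) t' _ ht'.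
  by rewrite -rmorphB norm_rc ltcR ger0_norm ?subr_ge0 // ltrBlDl.
have := heps t0; rewrite /root horner_cline ht0 eqxx => /(_ isT).
have := le_lt_trans (normc_ge_Im (t' - t0)) tt.
by rewrite ltcR raddfB /= => /ltr_normlW; lra.
Qed.

(* Garding: p is hyperbolic with respect to every point of the interior of the cone. *)
Lemma inner_cone_stable a c : inner_cone c -> ceval p (cvec a + ii *: cvec c) <> 0.
Proof.
move=> hc h.
have pc0 := inner_cone_neq0 hc.
(* The root t = i of p(a + t c) is followed to p(i alpha e + a + t c) with a small alpha > 0. It
   moves by less than 1, so it stays in the upper half plane, against [homotopy_Im]. *)
have h' : ceval p (cvec a + 0 *: (ii *: cvec e) + ii *: cvec c) = 0.
  by rewrite scale0r addr0.
have [delta /gt0_complexP[dl dl0 ->] hd] := ceval_root_lower p_homog pc0 ltr01 h'.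
have [|t ht it] := hd (rc (dl / 2)).
  by rewrite subr0 norm_rc ltcR gtr0_norm ?divr_gt0 // half_lt.
have := @homotopy_Im a c (dl / 2) t hc (divr_gt0 dl0 (ltr0Sn _ _)).
rewrite [_ *: _ + cvec a]addrC -scalerA => /(_ ht) It.
have : rc `|complex.Im (ii - t)| < rc 1 := le_lt_trans (normc_ge_Im (ii - t)) it.
rewrite ltcR raddfB /= => /ltr_normlW; lra.
Qed.

Lemma inner_cone_stableZ a c (eps : R) : eps != 0 -> inner_cone c ->
  ceval p (cvec a + (rc eps * ii) *: cvec c) <> 0.
Proof.
move=> e0 hc h; apply: (@inner_cone_stable (eps^-1 *: a) c hc).
have -> : cvec (eps^-1 *: a) + ii *: cvec c =
    rc eps^-1 *: (cvec a + (rc eps * ii) *: cvec c).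
  by rewrite map_mxZ scalerDr scalerA mulrA -rmorphM mulVf // rmorph1 mul1r.
by rewrite (ceval_homogZ _ _ p_homog) h mulr0.
Qed.

End Hyperbolicity.

Lemma line_shift (K : comNzRingType) (V : lmodType K) (x v c : V) (a s t m : K) :
  x + a *: v + (s * t) *: (c + m *: v) = x + s *: (t *: c) + (a + s * t * m) *: v.
Proof. by rewrite scalerDl scalerDr !scalerA -!addrA; congr (_ + _); rewrite addrCA. Qed.

Section InnerConeGeometry.
Variables (R : realType) (n : nat) (p : {mpoly R[n]}) (d : nat) (e : 'rV[R]_n).
Local Notation C := R[i].
Local Notation rc := (real_complex R).
Local Notation ii := ('i%C : C).
Hypothesis p_homog : p \is d.-homog.
Hypothesis pe0 : ceval p (cvec e) != 0.
Hypothesis p_real : forall (a : 'rV[R]_n) (z : C),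
  ceval p (z *: cvec e - cvec a) = 0 -> z \is Num.real.
Local Notation inner := (inner_cone p e).

(** The roots of p(z e - c - mu v) are real and, for small mu, close to the finitely many positive
    roots for mu = 0. *)
Lemma inner_cone_open c v : inner c ->
  exists2 delta : R, 0 < delta & forall mu, `|mu| < delta -> inner (c + mu *: v).
Proof.
move=> hc.
have [||eps eps0 heps] := @root_lbound R (cline p (- cvec c) (cvec e)) (@complex.Re R).
- apply/eqP => h0; move: pe0; have [_ <-] := cline_coef (- cvec c) (cvec e) p_homog.
  by rewrite h0 coef0 eqxx.
- move=> z /rootP; rewrite horner_cline addrC => /hc /gt0_complexP[r r0 ->] //.
have ceps : 0 < rc eps by rewrite rc_gt0.
have [delta /gt0_complexP[dl dl0 ->] hd] := ceval_root_upper (- cvec c) (- cvec v)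
   0 p_homog pe0 ceps.
exists dl => // mu mudl z hz.
have /complex_realP[x xE] := p_real hz.
have hz' : ceval p (- cvec c + rc mu *: - cvec v + z *: cvec e) = 0.
  by rewrite -hz scalerN -opprD addrC map_mxD map_mxZ.
have [|z0 hz0 zz] := hd (rc mu) z _ hz'.
  by rewrite subr0 norm_rc ltcR.
have ez0 : eps <= complex.Re z0.
  by apply: heps; apply/rootP; rewrite horner_cline -hz0 scale0r addr0.
have : rc `|complex.Re (z - z0)| < rc eps := le_lt_trans (normc_ge_Re (z - z0)) zz.
by rewrite xE rc_gt0 ltcR raddfB /= distrC => /ltr_normlW; lra.
Qed.

(* If the derivative of p along c vanished at x but not along v, then
   mu |-> p(x + i eps c + mu v) would have a root mu = O(eps^2), at which the
   imaginary part of the argument, of the form eps (c + O(eps) v), would be interior. *)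
Lemma inner_cone_tangent c x v : inner c ->
  ceval p (cvec x) = 0 -> dirder p (cvec x) (cvec c) = 0 ->
  dirder p (cvec x) (cvec v) = 0.
Proof.
move=> hc px dc.
have [dl dl0 hdl] := inner_cone_open v hc.
pose A0 := cline p (cvec x) (ii *: cvec c).
pose A1 := cline (dirpoly p v) (cvec x) (ii *: cvec c).
have [A2 A2E] : exists A2, A0 = A2 * 'X ^+ 2.
  have r0 : A0.[0] = 0 by rewrite horner_cline scale0r addr0.
  have /factor_theorem[B BE] : root A0 0 by apply/rootP.
  have r1 : B.[0] = 0.
    have : A0^`().[0] = 0 by rewrite horner_deriv_cline scale0r addr0 dirderZ dc mulr0.
    by rewrite BE polyC0 subr0 derivM derivX mulr1 hornerD hornerM hornerX mulr0 add0r.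
  have /factor_theorem[B2 B2E] : root B 0 by apply/rootP.
  by exists B2; rewrite BE B2E polyC0 subr0 expr2 mulrA.
pose K : C := 2 ^+ d.+1 / rc dl.
have cdl0 : 0 < rc dl by rewrite rc_gt0.
have K0 : 0 <= K by rewrite divr_ge0 ?exprn_ge0 // ltW.
(* The polynomial p(x + i eps c + z v) in z has no root with |z| < dl eps. So its linear coefficient
   A1(eps) is at most 2^(d+1) / (dl eps) times its constant one A0(eps) = A2(eps) eps^2, and eps
   tends to 0. *)
have key (eps : C) : 0 < eps < 1 -> `|A1.[eps]| <= K * `|(A2 * 'X).[eps]|.
  move=> /andP[/gt0_complexP[ep ep0 ->] _] {eps}.
  pose h := cline p (cvec x + rc ep *: (ii *: cvec c)) (cvec v).
  have rho0 : 0 < rc (dl * ep) by rewrite rc_gt0 mulr_gt0.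
  have hroots z : root h z -> rc (dl * ep) <= `|z|.
    move=> /rootP; rewrite horner_cline => hz.
    rewrite real_leNgt ?(gtr0_real rho0) ?normr_real //; apply/negP => zs.
    pose mu := complex.Im z / ep.
    have mus : `|mu| < dl.
      rewrite normrM normfV (gtr0_norm ep0) ltr_pdivrMr // -ltcR.
      exact: le_lt_trans (normc_ge_Im z) zs.
    have ep0' : ep != 0 by rewrite gt_eqF.
    apply: (@inner_cone_stableZ _ _ _ _ _ p_homog p_real (x + complex.Re z *: v) _ _ ep0' (hdl mu mus)).
    have zE : z = rc (complex.Re z) + (rc ep * ii) * rc mu.
      rewrite [LHS]complexE mulrAC -rmorphM /mu [ep * _]mulrC divfK //.
      by rewrite [_ * ii]mulrC.
    by rewrite !map_mxD !map_mxZ line_shift -zE.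
  have := coef_le_coef0 rho0 hroots 1%N; rewrite expr1.
  have -> : h`_1 = A1.[rc ep].
    rewrite horner_cline ceval_dirpoly.
    have <- : h^`().[0] = h`_1 by rewrite horner_coef0 coef_deriv mulr1n.
    by rewrite horner_deriv_cline scale0r addr0.
  have -> : h`_0 = A0.[rc ep].
    by rewrite -horner_coef0 horner_cline scale0r addr0 horner_cline.
  rewrite A2E => le1.
  have cep0 : 0 < rc ep by rewrite rc_gt0.
  rewrite -(ler_pM2r rho0); apply: (le_trans le1).
  have [szh _] := cline_coef (cvec x + rc ep *: (ii *: cvec c)) (cvec v) p_homog.
  have -> : K * `|(A2 * 'X).[rc ep]| * rc (dl * ep) =
      2 ^+ d.+1 * `|(A2 * 'X^2).[rc ep]|.
    rewrite (hornerM A2 'X) (hornerM A2 'X^2) hornerX hornerXn.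
    rewrite (normrM _ (rc ep)) (normrM _ (rc ep ^+ 2)) normrX (gtr0_norm cep0) rmorphM /K /=.
    by field; rewrite gt_eqF.
  by rewrite ler_wpM2r // ler_weXn2l // ler1n.
have := horner0_le K0 ltr01 key.
rewrite hornerM hornerX mulr0 normr0 mulr0 normr_le0 => /eqP.
by rewrite horner_cline scale0r addr0 ceval_dirpoly.
Qed.

Lemma real_root_inner c a y : inner c ->
  ceval p (cvec a + y *: cvec c) = 0 -> exists r : R, y = rc r.
Proof.
move=> hc h; apply/complex_realP; rewrite [y]complexE.
have [Iy|Iy] := eqVneq (complex.Im y) 0.
  by rewrite Iy rmorph0 mulr0 addr0 complex_real.
exfalso; apply: (@inner_cone_stableZ _ _ _ _ _ p_homog p_real (a + complex.Re y *: c) _ _ Iy hc).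
suff -> : cvec (a + complex.Re y *: c) + (rc (complex.Im y) * ii) *: cvec c
    = cvec a + y *: cvec c by [].
by rewrite [in RHS](complexE y) scalerDl addrA map_mxD map_mxZ [rc _ * ii]mulrC.
Qed.

(** For mu = - Dc / Dv the derivative along c + mu v is zero. If |mu| were small, this direction
    would be interior and [inner_cone_tangent] would give Dv = 0. *)
Lemma slope_bound c v : inner c -> exists2 delta : R, 0 < delta &
  forall x, ceval p (cvec x) = 0 ->
    rc delta * `|dirder p (cvec x) (cvec v)| <= `|dirder p (cvec x) (cvec c)|.
Proof.
move=> hc; have [dl dl0 hdl] := inner_cone_open v hc.
exists dl => // x px.
rewrite !dirder_real !norm_rc -rmorphM lecR leNgt; apply/negP => lt.
set Dv := (dirpoly p v).@[x 0] in lt *; set Dc := (dirpoly p c).@[x 0] in lt *.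
have Dv0 : Dv != 0.
  by apply: contraTneq lt => ->; rewrite normr0 mulr0 ltNge normr_ge0.
pose mu := - (Dc / Dv).
have mudl : `|mu| < dl by rewrite normrN normrM normfV ltr_pdivrMr ?normr_gt0.
suff : dirder p (cvec x) (cvec v) = 0.
  by rewrite dirder_real => /eqP; rewrite rc_eq0 (negPf Dv0).
apply: (inner_cone_tangent v (hdl mu mudl) px).
rewrite map_mxD map_mxZ dirderD dirderZ !dirder_real -/Dv -/Dc -rmorphM -rmorphD /mu.
by rewrite mulNr divfK // subrr rmorph0.
Qed.

End InnerConeGeometry.

(** * Plane sections and the discriminant *)

Section Gauss.
Variable R : realType.
Local Notation C := R[i].
Local Notation rc := (real_complex R).
Implicit Types (b f : {poly R}) (q g h : {poly {poly R}}).

(** The minimal polynomial of z over the reals. It serves to divide real coefficients that vanish at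
    a complex z without leaving the reals. *)
Lemma real_minimal_poly (z : C) b : b != 0 -> root (map_poly rc b) z ->
  exists2 m : {poly R}, (1 < size m)%N & forall f, root (map_poly rc f) z -> m %| f.
Proof.
move=> b0 bz.
pose P k := `[< exists f, [/\ f != 0, root (map_poly rc f) z & size f = k] >].
have exP : exists k, P k by exists (size b); apply/asboolP; exists b.
case: (ex_minnP exP) => k /asboolP[m [m0 mz mk]] kmin.
exists m => [|f fz].
  rewrite ltnNge; apply/negP => /size1_polyC mE.
  by move: mz m0; rewrite mE map_polyC rootC /= polyC_eq0 rc_eq0 => ->.
rewrite /dvdp; apply: contraT => r0.
have : P (size (f %% m)).
  apply/asboolP; exists (f %% m); split=> //.
  have -> : f %% m = f - f %/ m * m by rewrite {2}(divp_eq f m) addrAC subrr add0r.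
  by rewrite rmorphB rmorphM /root !hornerE (rootP fz) (rootP mz) mulr0 subr0.
by move/kmin; rewrite -mk leqNgt ltn_modp m0.
Qed.

Definition eval_coefs (z : C) : {rmorphism {poly R} -> C} := horner_eval z \o map_poly rc.

Lemma coefs_dvd (z : C) (m : {poly R}) g : m != 0 ->
  (forall f, root (map_poly rc f) z -> m %| f) -> map_poly (eval_coefs z) g = 0 ->
  exists2 g', g = m%:P * g' & size g' = size g.
Proof.
move=> m0 hm g0; pose g' := map_poly (fun c => c %/ m) g.
have gE : g = m%:P * g'.
  apply/polyP => i; rewrite coefCM coef_map_id0 ?div0p // mulrC divpK // hm //.
  have : (map_poly (eval_coefs z) g)`_i = 0 by rewrite g0 coef0.
  by rewrite coef_map /= /horner_eval => /rootP.
by exists g' => //; rewrite [in RHS]gE size_Cmul.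
Qed.

(* Gauss' lemma.  The denominator b is removed by induction on its degree: at a complex
   root of b, one of g and h vanishes identically. *)
Lemma gauss_factor b q g h : b != 0 -> b%:P * q = g * h ->
  exists g' h', [/\ q = g' * h', size g' = size g & size h' = size h].
Proof.
have [k] := ubnP (size b); elim: k b q g h => // k IH b q g h bk b0 E.
have [sb|sb] := eqVneq (size b) 1%N.
  have /size_poly1P[c c0 bE] : size b == 1%N by rewrite sb.
  exists ((c^-1)%:P%:P * g), h; split=> //.
    by rewrite -mulrA -E mulrA bE -!rmorphM mulVf // !rmorph1 mul1r.
  by rewrite size_Cmul // polyC_eq0 invr_eq0.
have [z bz] : exists z, root (map_poly rc b) z.
  by apply/closed_rootP; rewrite size_map_poly.
have [m m1 hm] := real_minimal_poly b0 bz.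
have m0 : m != 0 by rewrite -size_poly_gt0 ltnW.
have /dvdpP[b' b'E] := hm b bz.
have b'0 : b' != 0 by apply: contraNneq b0 => b'0; rewrite b'E b'0 mul0r.
have b'k : (size b' < k)%N.
  rewrite -ltnS; apply: leq_trans bk.
  rewrite b'E size_proper_mul ?mulf_neq0 ?lead_coef_eq0 //.
  by move: b'0 m1; rewrite -size_poly_gt0; case: (size m) => [|[|i]] // _ _; rewrite !addnS /= ltnS leq_addr.
have : map_poly (eval_coefs z) g * map_poly (eval_coefs z) h = 0.
  by rewrite -rmorphM -E rmorphM /= map_polyC /= /horner_eval (rootP bz) mul0r.
have mP0 : m%:P != 0 :> {poly {poly R}} by rewrite polyC_eq0.
move/eqP; rewrite mulf_eq0 => /orP[/eqP /(coefs_dvd m0 hm)|/eqP /(coefs_dvd m0 hm)].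
  move=> [g1 gE sg]; have [|g' [h' [qE sg' sh']]] := IH b' q g1 h b'k b'0.
    by apply: (mulfI mP0); rewrite mulrA -rmorphM mulrC [_ * b']mulrC -b'E mulrC E gE mulrA.
  by exists g', h'; rewrite -sg.
move=> [h1 hE sh]; have [|g' [h' [qE sg' sh']]] := IH b' q g h1 b'k b'0.
  by apply: (mulfI mP0); rewrite mulrA -rmorphM mulrC [_ * b']mulrC -b'E mulrC E hE mulrCA.
by exists g', h'; rewrite -sh.
Qed.

End Gauss.

(** * Linear changes of coordinates and passage to affine charts *)

Section LinearSubstitution.
Variables (R : comNzRingType) (n : nat).
Implicit Types (M N : 'M[R]_n).

(** The row vector u times M, over any R-algebra, so that one formula serves for numbers,
    polynomials and fractions. *)
Definition lin (S : comNzRingType) (iS : {rmorphism R -> S}) M (u : 'I_n -> S) : 'I_n -> S :=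
  fun i => \sum_j u j * iS (M j i).

Lemma lin_morph (S T : comNzRingType) (psi : {rmorphism S -> T})
    (iS : {rmorphism R -> S}) (iT : {rmorphism R -> T}) M u i :
  (forall c, psi (iS c) = iT c) -> psi (lin iS M u i) = lin iT M (psi \o u) i.
Proof. by move=> h; rewrite rmorph_sum; apply: eq_bigr => j _; rewrite rmorphM h. Qed.

Lemma eq_lin (S : comNzRingType) (iS : {rmorphism R -> S}) M u u' :
  u =1 u' -> lin iS M u =1 lin iS M u'.
Proof. by move=> h i; apply: eq_bigr => j _; rewrite h. Qed.

Lemma lin_scale (S : comNzRingType) (iS : {rmorphism R -> S}) M k u i :
  lin iS M (fun j => k * u j) i = k * lin iS M u i.
Proof. by rewrite mulr_sumr; apply: eq_bigr => j _; rewrite mulrA. Qed.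

Lemma linK (S : comNzRingType) (iS : {rmorphism R -> S}) M N u i : M *m N = 1%:M ->
  lin iS N (lin iS M u) i = u i.
Proof.
move=> MN; rewrite /lin; under eq_bigr do rewrite mulr_suml.
rewrite exchange_big /= (bigD1 i) //= [X in _ + X]big1 ?addr0 => [|j ji].
  under eq_bigr do rewrite -mulrA -rmorphM.
  rewrite -mulr_sumr -rmorph_sum.
  by have := congr1 (fun A : 'M__ => A i i) MN; rewrite !mxE eqxx => ->; rewrite rmorph1 mulr1.
under eq_bigr do rewrite -mulrA -rmorphM.
rewrite -mulr_sumr -rmorph_sum.
have := congr1 (fun A : 'M__ => A j i) MN; rewrite !mxE (negPf ji) => ->.
by rewrite rmorph0 mulr0.
Qed.

End LinearSubstitution.

Section BivariateEvaluation.
Variable R : comNzRingType.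

Definition ev2 (S : comNzRingType) (iS : {rmorphism R -> S}) (s y : S) :
  {rmorphism {poly {poly R}} -> S} := horner_eval y \o map_poly (horner_eval s \o map_poly iS).

Lemma ev2E (S : comNzRingType) (iS : {rmorphism R -> S}) s y g :
  ev2 iS s y g = (map_poly (horner_eval s \o map_poly iS) g).[y].
Proof. by []. Qed.

Lemma ev2_y (S : comNzRingType) (iS : {rmorphism R -> S}) s y : ev2 iS s y 'X = y.
Proof. by rewrite ev2E map_polyX hornerX. Qed.

Lemma ev2_polyC (S : comNzRingType) (iS : {rmorphism R -> S}) s y c :
  ev2 iS s y c%:P = (map_poly iS c).[s].
Proof. by rewrite ev2E map_polyC hornerC. Qed.

Lemma ev2_s (S : comNzRingType) (iS : {rmorphism R -> S}) s y : ev2 iS s y 'X%:P = s.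
Proof. by rewrite ev2_polyC map_polyX hornerX. Qed.

Lemma ev2_c (S : comNzRingType) (iS : {rmorphism R -> S}) s y c : ev2 iS s y c%:P%:P = iS c.
Proof. by rewrite ev2_polyC map_polyC hornerC. Qed.

Lemma ev2_morph (S T : comNzRingType) (psi : {rmorphism S -> T})
    (iS : {rmorphism R -> S}) (iT : {rmorphism R -> T}) s y g :
  (forall c, psi (iS c) = iT c) -> psi (ev2 iS s y g) = ev2 iT (psi s) (psi y) g.
Proof.
move=> h; rewrite !ev2E -horner_map; congr (_.[_]).
rewrite -map_poly_comp; apply: eq_map_poly => c /=.
rewrite /horner_eval -horner_map -map_poly_comp; congr (_.[_]).
exact: eq_map_poly.
Qed.

Lemma ev2_id g : ev2 (polyC \o polyC) 'X%:P 'X g = g.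
Proof.
rewrite ev2E -[RHS]comp_polyXr /comp_poly; congr (_.[_]); apply: eq_map_poly => c /=.
rewrite /horner_eval (map_poly_comp polyC polyC) /= horner_map; congr polyC.
by rewrite -[RHS]comp_polyXr.
Qed.

Definition pair2 (S : nzRingType) (s y : S) : 'I_2 -> S := nth 0 [:: s; y].
Definition triple (S : nzRingType) (a b c : S) : 'I_3 -> S := nth 0 [:: a; b; c].

Lemma tripleE (S : nzRingType) (u : 'I_3 -> S) :
  u =1 triple (u ord0) (u (lift ord0 ord0)) (u ord_max).
Proof. by move=> [[|[|[]]] //= h]; rewrite /triple /=; congr u; apply: val_inj. Qed.

Lemma triple_comp (S T : nzRingType) (psi : S -> T) a b c :
  psi \o triple a b c =1 triple (psi a) (psi b) (psi c).
Proof. by move=> [[|[|[]]]]. Qed.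

Definition to_mpoly2 : {poly {poly R}} -> {mpoly R[2]} :=
  ev2 (@mpolyC 2 R) 'X_ord0 'X_ord_max.

End BivariateEvaluation.

Section Homogenization.
Variables (R : comNzRingType) (n : nat).
Implicit Types f : {mpoly R[n]}.

(* Homogenization of f to degree k, evaluated at (h0 : h); the exponent k - mdeg m is a
   truncated subtraction. *)
Definition mhom (S : comNzRingType) (iS : {rmorphism R -> S}) k f (h0 : S) (h : 'I_n -> S) : S :=
  \sum_(m <- msupp f) iS f@_m * (h0 ^+ (k - mdeg m) * mmap1 h m).

Lemma mhomE (S : comNzRingType) (iS : {rmorphism R -> S}) k f a h :
  (msize f <= k.+1)%N -> mhom iS k f a (fun i => a * h i) = a ^+ k * mmap iS h f.
Proof.
move=> sf; rewrite /mhom /mmap mulr_sumr !big_seq; apply: eq_bigr => m mf.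
rewrite [RHS]mulrCA; congr (_ * _).
have mk : (mdeg m <= k)%N by rewrite -ltnS (leq_trans (msize_mdeg_lt mf)).
rewrite -[in RHS](subnK mk) exprD -mulrA; congr (_ * _).
rewrite /mmap1 mdegE -prodrXr -big_split.
by apply: eq_bigr => i _; rewrite exprMn.
Qed.

Lemma mhom_morph (S T : comNzRingType) (psi : {rmorphism S -> T})
    (iS : {rmorphism R -> S}) (iT : {rmorphism R -> T}) k f h0 h hT :
  (forall c, psi (iS c) = iT c) -> (forall i, psi (h i) = hT i) ->
  psi (mhom iS k f h0 h) = mhom iT k f (psi h0) hT.
Proof.
move=> hi hh; rewrite rmorph_sum; apply: eq_bigr => m _.
rewrite !rmorphM hi rmorphXn; congr (_ * (_ * _)).
by rewrite /mmap1 rmorph_prod; apply: eq_bigr => i _; rewrite rmorphXn hh.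
Qed.

Lemma mhom_homog l (h0 : {mpoly R[l]}) (h : 'I_n -> {mpoly R[l]}) k f :
  (msize f <= k.+1)%N -> h0 \is 1.-homog -> (forall i, h i \is 1.-homog) ->
  mhom (@mpolyC l R) k f h0 h \is k.-homog.
Proof.
move=> sf hh0 hh; rewrite /mhom big_seq; apply: rpred_sum => m mf.
have mk : (mdeg m <= k)%N by rewrite -ltnS (leq_trans (msize_mdeg_lt mf)).
rewrite mul_mpolyC; apply: rpredZ.
rewrite -[X in _ \is X.-homog](subnK mk); apply: dhomogM.
  by rewrite -[X in X.-homog]mul1n; apply: dhomogMn.
rewrite /mmap1 mdegE; elim/big_ind2 : _ => [|a P b Q|i _]; first exact: dhomog1.
  exact: dhomogM.
by rewrite -[X in X.-homog]mul1n; apply: dhomogMn.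
Qed.

Lemma mmap_mpolyX f : mmap (@mpolyC n R) (fun i => 'X_i) f = f.
Proof.
rewrite [RHS]mpolyE; apply: eq_bigr => m _.
by rewrite mul_mpolyC mmap1_id.
Qed.

End Homogenization.

Lemma msize_mmap_le (R : idomainType) n l (h : 'I_n -> {mpoly R[l]}) d (f : {mpoly R[n]}) : f \is d.-homog ->
  (forall i, (msize (h i) <= 2)%N) -> (msize (mmap (@mpolyC l R) h f) <= d.+1)%N.
Proof.
move=> /dhomogP hf hh.
have szM (a b : nat) (P Q : {mpoly R[l]}) :
    (msize P <= a.+1)%N -> (msize Q <= b.+1)%N -> (msize (P * Q) <= (a + b).+1)%N.
  have [->|P0] := eqVneq P 0; first by rewrite mul0r msize0.
  have [->|Q0] := eqVneq Q 0; first by rewrite mulr0 msize0.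
  by move=> hP hQ; rewrite msizeM //; move: hP hQ; lia.
rewrite /mmap big_seq; elim/big_ind : _ => [|P Q hP hQ|m mf].
- by rewrite msize0.
- by rewrite (leq_trans (msizeD_le _ _)) // geq_max hP.
- rewrite -[d]add0n; apply: (szM); first by rewrite msizeC leq_b1.
  have <- : mdeg m = d := hf _ mf; rewrite mdegE /mmap1.
  elim/big_ind2 : _ => [|a P b Q|i _]; first by rewrite msize1.
    by move=> hP hQ; apply: (szM).
  elim: (m i) => [|k IH]; first by rewrite expr0 msize1.
  by rewrite exprS -[k.+1]add1n; apply: (szM).
Qed.

Section PlaneSections.
Variables (R : realType) (B Bi : 'M[R]_3).
Hypotheses (BiB : Bi *m B = 1%:M) (BBi : B *m Bi = 1%:M).
Implicit Types f : {mpoly R[3]}.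

Local Notation cc2 := (@polyC {poly R} \o @polyC R).

(* The restriction of f to the affine plane (row 0 B) + s (row 1 B) + y (row 2 B),
   as a polynomial in y over the polynomials in s. *)
Definition plane_poly f : {poly {poly R}} :=
  mmap cc2 (lin cc2 B (triple 1 'X%:P 'X)) f.

Lemma ev2_plane_poly (S : comNzRingType) (iS : {rmorphism R -> S}) s y f :
  ev2 iS s y (plane_poly f) = mmap iS (lin iS B (triple 1 s y)) f.
Proof.
apply: mmap_morph => [c|i]; first exact: ev2_c.
rewrite (lin_morph (iT := iS)) => [|c]; last exact: ev2_c.
apply: eq_lin => j; rewrite triple_comp ev2_y ev2_s.
by rewrite (rmorph1 (ev2 iS s y)).
Qed.

Lemma plane_poly_coef d f : f \is d.-homog ->
  (size (plane_poly f) <= d.+1)%N /\ (plane_poly f)`_d = (f.@[B ord_max])%:P.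
Proof.
move=> hf.
have -> : plane_poly f = mmap cc2
   (fun i => ((B ord0 i)%:P + (B (lift ord0 ord0) i) *: 'X)%:P + (B ord_max i)%:P%:P * 'X) f.
  apply: eq_mmap => // i; rewrite /lin !big_ord_recl big_ord0 /triple /= addr0 mul1r.
  rewrite polyCD addrA; congr (_ + _ + _).
    by rewrite -mul_polyC polyCM mulrC.
  by rewrite mulrC; congr (_%:P%:P * _); congr (B _ _); apply: val_inj.
have [sz ->] := mmap_linear_coef (polyC : {rmorphism R -> {poly R}}) (fun i => (B ord0 i)%:P + (B (lift ord0 ord0) i) *: 'X)
  (fun i => (B ord_max i)%:P) hf.
split=> //; apply/esym; exact: mmap_morph.
Qed.

(** Homogenizing g and h with respect to the linear form [u ord0] yields a factorization of f. It is
    checked in the fraction field, where one can divide by that form. Neither factor is a unit,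
    because [psi] maps it back to g or h, of positive degree in y. *)
Lemma plane_poly_irreducible d f g h : irreducible_mpoly f -> f \is d.-homog ->
  plane_poly f = g * h -> (1 < size g)%N -> (1 < size h)%N -> False.
Proof.
move=> [f0 _ firr] hf E sg sh.
pose u := lin (@mpolyC 3 R) Bi (fun i => 'X_i).
pose K := {fraction {mpoly R[3]}}.
pose iK : {rmorphism R -> K} := @tofrac {mpoly R[3]} \o @mpolyC 3 R.
pose psi : {rmorphism {mpoly R[3]} -> {poly {poly R}}} :=
  mmap cc2 (lin cc2 B (triple 1 'X%:P 'X)).
have psiC c : psi c%:MP = c%:P%:P by rewrite /psi /= mmapC.
have psiu i : psi (u i) = triple 1 'X%:P 'X i.
  rewrite (lin_morph (iT := cc2)) //.
  rewrite (@eq_lin _ _ _ _ _ _ (lin cc2 B (triple 1 'X%:P 'X))) ?linK // => j.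
  by rewrite /= mmapX mmap1U.
have u00 : u ord0 != 0.
  by apply: contra_neq (oner_neq0 {poly {poly R}}) => h0; have := psiu ord0; rewrite h0 rmorph0.
pose a := tofrac (u ord0); pose b := tofrac (u (lift ord0 ord0)); pose c := tofrac (u ord_max).
have a0 : a != 0 by rewrite tofrac_eq0.
pose H k l := mhom (@mpolyC 3 R) k (to_mpoly2 l) (u ord0) (pair2 (u (lift ord0 ord0)) (u ord_max)).
have HK k l : (msize (to_mpoly2 l) <= k.+1)%N ->
    tofrac (H k l) = a ^+ k * ev2 iK (b / a) (c / a) l.
  move=> hs; rewrite (@mhom_morph _ _ _ _ _ _ iK _ _ _ _ (fun i => a * pair2 (b / a) (c / a) i)) //; last first.
    by move=> [[|[]]] //= ?; rewrite /pair2 /= mulrC divfK.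
  rewrite mhomE //; congr (_ * _); rewrite /to_mpoly2.
  have := (@ev2_morph _ _ _ (mmap iK (pair2 (b / a) (c / a))) (@mpolyC 2 R) iK 'X_ord0 'X_ord_max l).
  by rewrite /= !mmapX !mmap1U; apply=> r; rewrite mmapC.
have toK (l : {poly {poly R}}) : mmap cc2 (pair2 'X%:P 'X) (to_mpoly2 l) = l.
  rewrite -[RHS]ev2_id /to_mpoly2.
  have := (@ev2_morph _ _ _ (mmap cc2 (pair2 'X%:P 'X)) (@mpolyC 2 R) cc2 'X_ord0 'X_ord_max l).
  by rewrite /= !mmapX !mmap1U; apply=> r; rewrite mmapC.
have Hpsi k l : (msize (to_mpoly2 l) <= k.+1)%N -> psi (H k l) = l.
  move=> hs; rewrite (@mhom_morph _ _ _ _ _ _ cc2 _ _ _ _ (fun i => 1 * pair2 'X%:P 'X i)) //; last first.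
    by move=> [[|[]]] //= ?; rewrite mul1r (psiu _).
  by rewrite psiu mhomE // expr1n mul1r toK.
have nz (l : {poly {poly R}}) : l != 0 -> to_mpoly2 l != 0.
  by apply: contra_neq => l0; rewrite -(toK l) l0 mmap0.
have g0 : to_mpoly2 g != 0 by apply: nz; rewrite -size_poly_gt0 ltnW.
have h0 : to_mpoly2 h != 0 by apply: nz; rewrite -size_poly_gt0 ltnW.
have szgh : ((msize (to_mpoly2 g) + msize (to_mpoly2 h)).-1 <= d.+1)%N.
  rewrite -msizeM // -rmorphM -E /to_mpoly2 ev2_plane_poly.
  apply: msize_mmap_le => // i; rewrite /lin !big_ord_recl big_ord0 addr0 /triple /= mul1r.
  rewrite ['X_ord0 * _]mulrC ['X_ord_max * _]mulrC !mul_mpolyC.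
  rewrite (leq_trans (msizeD_le _ _)) // geq_max msizeC (leq_trans (leq_b1 _)) //=.
  rewrite (leq_trans (msizeD_le _ _)) // geq_max.
  by rewrite !(leq_trans (msizeZ_le _ _)) // msizeX mdeg1.
have mg : (0 < msize (to_mpoly2 g))%N by rewrite lt0n msize_poly_eq0.
have mh : (0 < msize (to_mpoly2 h))%N by rewrite lt0n msize_poly_eq0.
(* k is the total degree of g; the rest of the degree d goes to h and is at least its total
   degree. *)
pose k := (msize (to_mpoly2 g)).-1; pose l := (d - k)%N.
have kg : (msize (to_mpoly2 g) <= k.+1)%N by rewrite /k prednK.
have lh : (msize (to_mpoly2 h) <= l.+1)%N by rewrite /l /k; lia.
have kl : (k + l = d)%N by rewrite /l /k; lia.
have fE : f = H k g * H l h.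
  apply/eqP; rewrite -tofrac_eq; apply/eqP.
  rewrite tofracM HK // HK // mulrACA -exprD kl -rmorphM -E ev2_plane_poly.
  rewrite -(mmap_homogZ _ _ _ hf).
  rewrite -[in LHS](mmap_mpolyX f).
  apply: mmap_morph => // i; rewrite -lin_scale.
  have <- : lin (@mpolyC 3 R) B u i = 'X_i by rewrite linK.
  rewrite (lin_morph (iT := iK)) //; apply: eq_lin => j.
  rewrite /= (tripleE u j).
  by case: j => [[|[|[]]]] //= ?; rewrite /triple /= ?mulr1 // mulrC divfK.
have unit_size k' l' : (msize (to_mpoly2 l') <= k'.+1)%N -> H k' l' \is a GRing.unit -> size l' = 1%N.
  move=> hs /(rmorph_unit psi); rewrite Hpsi // poly_unitE => /andP[/eqP //].
case: (firr _ _ fE) => /unit_size.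
  by move=> /(_ kg) s1; move: sg; rewrite s1.
by move=> /(_ lh) s1; move: sh; rewrite s1.
Qed.

(** D need not be the discriminant itself, only a nonzero element without y in the ideal of q and
    its derivative. If the gcd of the two had positive degree in y, then Gauss' lemma would make it,
    up to denominators, a proper factor of q. *)
Lemma discriminant d f : irreducible_mpoly f -> f \is d.-homog ->
  f.@[B ord_max] != 0 ->
  exists D u v, D != 0 /\
    D%:P = u * plane_poly f + v * (plane_poly f)^`() :> {poly {poly R}}.
Proof.
move=> firr hf fw.
have [sz lc] := plane_poly_coef hf; set q := plane_poly f in sz lc *.
have d0 := irreducible_homog_pos firr hf.
have lc0 : q`_d != 0 by rewrite lc polyC_eq0.
have szq : size q = d.+1.
  by apply/eqP; rewrite eqn_leq sz ltnNge; apply: contra lc0 => /leq_sizeP ->.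
have q0 : q != 0 by rewrite -size_poly_gt0 szq.
have q'0 : q^`() != 0.
  have : q^`()`_d.-1 != 0.
    rewrite coef_deriv prednK // -mulr_natr mulf_neq0 //.
    by rewrite -!polyC_natr !polyC_eq0 pnatr_eq0 -lt0n.
  by apply: contraNneq => ->; rewrite coef0.
have [w wE] := Pdiv.Idomain.Bezoutp q q^`().
set m := Pdiv.Idomain.gcdp q q^`() in wE *.
have m0 : m != 0 by rewrite Pdiv.Idomain.gcdp_eq0 (negPf q0).
have [m1|m1] := leqP (size m) 1.
  have := Pdiv.Idomain.eqp_size wE.
  have /size_poly1P[r r0 ->] : size m == 1%N by rewrite eqn_leq m1 size_poly_gt0.
  rewrite size_polyC r0 => /eqP/size_poly1P[D D0 DE].
  by exists D, w.1, w.2; rewrite DE.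
have /Pdiv.Idomain.dvdpP[[c h] /= c0] : Pdiv.Idomain.dvdp m q := Pdiv.Idomain.dvdp_gcdl _ _.
rewrite -mul_polyC => E.
have [g' [h' [qE sg sh]]] := gauss_factor c0 E.
have sm : (size m <= d)%N.
  apply: leq_trans (Pdiv.Idomain.leq_gcdpr q q'0) _.
  by rewrite -ltnS -szq lt_size_deriv.
exfalso; apply: (plane_poly_irreducible firr hf qE); last by rewrite sh.
have g'0 : g' != 0 by apply: contraNneq q0 => g'0; rewrite qE g'0 mul0r.
have h'0 : h' != 0 by apply: contraNneq q0 => h'0; rewrite qE h'0 mulr0.
have := size_mul g'0 h'0; rewrite -qE szq sh; move: sm d0.
move: (size g') (size m); clear; lia.
Qed.
End PlaneSections.

(** * Tangent spaces and the dual curve *)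

Section Frames.
Variable R : realType.
Implicit Types l e : 'rV[R]_3.

Lemma sum3 (S : nzRingType) (F : 'I_3 -> S) :
  \sum_i F i = F ord0 + F (lift ord0 ord0) + F ord_max.
Proof.
rewrite !big_ord_recl big_ord0 addr0 addrA; congr (_ + _ + F _); exact: val_inj.
Qed.

Lemma ord3P (P : 'I_3 -> Prop) :
  P ord0 -> P (lift ord0 ord0) -> P ord_max -> forall i, P i.
Proof.
move=> P0 P1 P2 [[|[|[|//]]] h].
- by rewrite (_ : Ordinal h = ord0) //; apply: val_inj.
- by rewrite (_ : Ordinal h = lift ord0 ord0) //; apply: val_inj.
- by rewrite (_ : Ordinal h = ord_max) //; apply: val_inj.
Qed.

Lemma sum_sqr_gt0 e : e != 0 -> 0 < \sum_i e 0 i ^+ 2.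
Proof.
move=> e0; rewrite lt_def sumr_ge0 ?andbT => [|i _]; last exact: sqr_ge0.
apply: contra e0; rewrite psumr_eq0 => [/allP h|i _]; last exact: sqr_ge0.
apply/eqP/rowP => i; rewrite mxE; apply/eqP.
by have := h i (mem_index_enum _); rewrite sqrf_eq0.
Qed.

(** The rows are the cross product of l and e, then l, then e. They are orthogonal, so the inverse
    is the transpose with each column divided by a squared length. *)
Lemma orthogonal_frame l e : l != 0 -> e != 0 -> pairing l e = 0 ->
  exists B Bi : 'M[R]_3, [/\ B *m Bi = 1%:M, Bi *m B = 1%:M,
    row ord_max B = e, row (lift ord0 ord0) B = l & pairing l (row ord0 B) = 0].
Proof.
move=> l0 e0; rewrite /pairing sum3.
have := sum_sqr_gt0 l0; have := sum_sqr_gt0 e0; rewrite !sum3.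
set l1 := l 0 ord0; set l2 := l 0 (lift _ _); set l3 := l 0 ord_max.
set e1 := e 0 ord0; set e2 := e 0 (lift _ _); set e3 := e 0 ord_max.
move=> se sl le.
pose c : 'rV[R]_3 := \row_j triple (l2 * e3 - l3 * e2) (l3 * e1 - l1 * e3) (l1 * e2 - l2 * e1) j.
pose B : 'M[R]_3 := \matrix_(i, j) triple (c 0 j) (l 0 j) (e 0 j) i.
have B0 j : B ord0 j = c 0 j by rewrite [LHS]mxE.
have B1 j : B (lift ord0 ord0) j = l 0 j by rewrite [LHS]mxE.
have B2 j : B ord_max j = e 0 j by rewrite [LHS]mxE.
(* Lagrange's identity for the length of a cross product. *)
have sc : (l2 * e3 - l3 * e2) ^+ 2 + (l3 * e1 - l1 * e3) ^+ 2 + (l1 * e2 - l2 * e1) ^+ 2 != 0.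
  have -> : (l2 * e3 - l3 * e2) ^+ 2 + (l3 * e1 - l1 * e3) ^+ 2 + (l1 * e2 - l2 * e1) ^+ 2
    = (l1 ^+ 2 + l2 ^+ 2 + l3 ^+ 2) * (e1 ^+ 2 + e2 ^+ 2 + e3 ^+ 2)
      - (l1 * e1 + l2 * e2 + l3 * e3) ^+ 2 by ring.
  by rewrite le expr0n subr0 mulf_neq0 // gt_eqF.
pose Bi : 'M[R]_3 := \matrix_(j, i) (B i j / \sum_k B i k ^+ 2).
have BBi : B *m Bi = 1%:M.
{ apply/matrixP => i j; rewrite [LHS]mxE [RHS]mxE.
  transitivity ((\sum_k B i k * B j k) / \sum_k B j k ^+ 2).
    by rewrite mulr_suml; apply: eq_bigr => k _; rewrite [Bi _ _]mxE mulrA.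
  move: i j.
  apply: ord3P; apply: ord3P; rewrite /= ?mulr1n ?mulr0n !sum3 ?B0 ?B1 ?B2 ?mxE /triple /=
    -?/l1 -?/l2 -?/l3 -?/e1 -?/e2 -?/e3 -?expr2.
  all: try by rewrite mulfV // gt_eqF.
  all: match goal with |- ?x / _ = _ => suff -> : x = 0 by rewrite mul0r end.
  all: try by ring.
  all: by rewrite // -[RHS]le; ring. }
exists B, Bi; split=> //; first exact: mulmx1C.
- by apply/rowP => j; rewrite mxE B2.
- by apply/rowP => j; rewrite mxE B1.
- by rewrite sum3 !mxE /triple /= -/l1 -/l2 -/l3; ring.
Qed.

Lemma frame_exists e : e != 0 ->
  exists B Bi : 'M[R]_3, [/\ B *m Bi = 1%:M, Bi *m B = 1%:M & row ord_max B = e].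
Proof.
move=> e0.
suff [l [l0 le]] : exists l : 'rV[R]_3, l != 0 /\ pairing l e = 0.
  by have [B [Bi [h1 h2 h3 _ _]]] := orthogonal_frame l0 e0 le; exists B, Bi.
pose e1 := e 0 ord0; pose e2 := e 0 (lift ord0 ord0).
have [e10|e10] := eqVneq e1 0.
  exists (\row_j triple 1 0 0 j); split.
    by apply/eqP => /rowP /(_ ord0) /eqP; rewrite !mxE /triple /= oner_eq0.
  by rewrite /pairing sum3 !mxE /triple /= -/e1 e10; ring.
exists (\row_j triple (- e2) e1 0 j); split.
  by apply/eqP => /rowP /(_ (lift ord0 ord0)) /eqP; rewrite !mxE /triple /= (negPf e10).
by rewrite /pairing sum3 !mxE /triple /= -/e1 -/e2; ring.
Qed.

End Frames.

Lemma poly_eq0_nat (K : numDomainType) (f : {poly K}) : (forall n : nat, f.[n%:R] = 0) -> f = 0.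
Proof.
move=> h; apply/eqP; apply: contraT => f0.
have := max_poly_roots f0 (_ : all (root f) [seq i%:R | i <- iota 0 (size f)]).
rewrite size_map size_iota ltnn => -> //; first by apply/allP => _ /mapP[i _ ->]; apply/rootP.
rewrite map_inj_uniq ?iota_uniq // => i j /eqP; by rewrite eqr_nat => /eqP.
Qed.

(** * Forms vanishing on the curve *)

Section Nullstellensatz.
Variables (R : realType) (B Bi : 'M[R]_3) (p : {mpoly R[3]}) (d : nat).
Local Notation C := R[i].
Local Notation rc := (real_complex R).
Hypotheses (BiB : Bi *m B = 1%:M) (BBi : B *m Bi = 1%:M).
Hypotheses (p_irr : irreducible_mpoly p) (p_homog : p \is d.-homog).
Hypothesis pw0 : p.@[B ord_max] != 0.

Definition frame_pt (u : 'I_3 -> C) : 'rV[C]_3 := \row_i lin rc B u i.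

Lemma ceval_frame_pt f u : ceval f (frame_pt u) = mmap rc (lin rc B u) f.
Proof. by apply: ceval_mmapE => i; rewrite mxE. Qed.

Lemma ceval_plane_poly f s y :
  ceval f (frame_pt (triple 1 s y)) = ev2 rc s y (plane_poly B f).
Proof. by rewrite ceval_frame_pt ev2_plane_poly. Qed.

Lemma frame_ptK u i : lin rc Bi ((frame_pt u) 0) i = u i.
Proof.
rewrite -[RHS](linK rc u i BBi); apply: eq_lin => j; by rewrite mxE.
Qed.

Lemma frame_pt_coords (x : 'rV[C]_3) : frame_pt (lin rc Bi (x 0)) = x.
Proof. by apply/rowP => i; rewrite mxE linK. Qed.

Lemma frame_pt_neq0 u i : u i != 0 -> frame_pt u != 0.
Proof.
apply: contra_neq => h; rewrite -(frame_ptK u i) h /lin big1 // => j _.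
by rewrite mxE mul0r.
Qed.

Lemma plane_poly_size : size (plane_poly B p) = d.+1 /\
  lead_coef (plane_poly B p) = (p.@[B ord_max])%:P.
Proof.
have [sz lc] := plane_poly_coef B p_homog.
have szq : size (plane_poly B p) = d.+1.
  apply/eqP; rewrite eqn_leq sz ltnNge; apply/negP => /leq_sizeP /(_ d (leqnn _)).
  by rewrite lc => /eqP; rewrite polyC_eq0 (negPf pw0).
by rewrite lead_coefE szq.
Qed.

Lemma plane_fiber_size s : size (map_poly (eval_coefs s) (plane_poly B p)) = d.+1.
Proof.
have [sz lc] := plane_poly_size; rewrite size_map_poly_id0 ?sz //.
by rewrite lc /= map_polyC /= /horner_eval hornerC rc_eq0.
Qed.

Lemma fiber_separable D u v s :
  D%:P = u * plane_poly B p + v * (plane_poly B p)^`() ->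
  (map_poly rc D).[s] != 0 ->
  separable_poly (map_poly (eval_coefs s) (plane_poly B p)).
Proof.
move=> E Ds; rewrite unlock; apply/Bezout_coprimepP.
exists (map_poly (eval_coefs s) u, map_poly (eval_coefs s) v) => /=.
rewrite deriv_map -!rmorphM -rmorphD -E /= map_polyC /= /horner_eval.
by rewrite polyC_eqp1.
Qed.

(* The remainder of the division by p vanishes at d distinct points of every fiber on
   which the discriminant does not vanish. *)
Lemma plane_poly_dvd f :
  (forall x : 'rV[C]_3, x != 0 -> ceval p x = 0 -> ceval f x = 0) ->
  exists g, plane_poly B f = g * plane_poly B p.
Proof.
move=> hf.
have [D [u [v [D0 DE]]]] := discriminant BiB BBi p_irr p_homog pw0.
have [szq lcq] := plane_poly_size.
set q := plane_poly B p in DE szq lcq *; set F := plane_poly B f.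
have ulc : lead_coef q \is a GRing.unit by rewrite lcq rmorph_unit // unitfE.
have q0 : q != 0 by rewrite -size_poly_gt0 szq.
have FE := Pdiv.IdomainUnit.divp_eq ulc F.
set G := Pdiv.Idomain.divp F q in FE; set r := Pdiv.Idomain.modp F q in FE.
have szr : (size r < size q)%N by rewrite Pdiv.Idomain.ltn_modpN0.
suff r0 : r = 0 by exists G; rewrite FE r0 addr0.
have fib s : (map_poly rc D).[s] != 0 -> map_poly (eval_coefs s) r = 0.
  move=> Ds; apply/eqP; apply: contraT => rs0.
  have sep := fiber_separable DE Ds; rewrite -/q in sep.
  have [zs qsE] := closed_field_poly_normal (map_poly (eval_coefs s) q).
  have szs := plane_fiber_size s; rewrite -/q in szs.
  have qs0 : lead_coef (map_poly (eval_coefs s) q) != 0.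
    by rewrite lead_coef_eq0 -size_poly_gt0 szs.
  have uzs : uniq zs.
    by move: sep; rewrite qsE (eqp_separable (eqp_scale _ qs0)) separable_prod_XsubC.
  have hz : all (root (map_poly (eval_coefs s) r)) zs.
    apply/allP => z zz; have rz : root (map_poly (eval_coefs s) q) z.
      by rewrite qsE rootZ // root_prod_XsubC.
    have x0 : frame_pt (triple 1 s z) != 0.
      by apply: (@frame_pt_neq0 _ ord0); rewrite /triple /= oner_eq0.
    have := hf _ x0; rewrite !ceval_plane_poly !ev2E => /(_ (rootP rz)).
    by rewrite -/F FE rmorphD rmorphM /= hornerD hornerM (rootP rz) mulr0 add0r => /rootP.
  have := max_poly_roots rs0 hz uzs.
  have -> : size zs = d.
    by apply/eq_add_S; rewrite -szs qsE size_scale // size_prod_XsubC.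
  by rewrite ltnNge (leq_trans (size_poly _ _)) // -ltnS -szq.
apply/polyP => i; rewrite coef0.
suff : map_poly rc (D * r`_i) = 0.
  by move/eqP; rewrite map_poly_eq0 mulf_eq0 (negPf D0) => /eqP.
apply: poly_eq0_nat => n; rewrite rmorphM hornerM.
have [->|Dn] := eqVneq (map_poly rc D).[n%:R] 0; first by rewrite mul0r.
have := congr1 (fun P : {poly C} => P`_i) (fib _ Dn).
by rewrite coef_map coef0 /= /horner_eval => ->; rewrite mulr0.
Qed.

(** By Euler's relation, subtracting a multiple of x from v changes neither derivative, so the first
    frame coordinate of v may be taken to be 0. Then x + t v stays in the chart with affine
    coordinates [S1] and [S2], where f is a multiple of p. *)
Lemma tangent_vanishing_chart f k (x v : 'rV[C]_3) : f \is k.-homog ->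
  (forall x : 'rV[C]_3, x != 0 -> ceval p x = 0 -> ceval f x = 0) ->
  lin rc Bi (x 0) ord0 != 0 ->
  ceval p x = 0 -> dirder p x v = 0 -> dirder f x v = 0.
Proof.
move=> hf hfp u0 px pv.
have x0 : x != 0.
  apply: contra_neq u0 => ->; rewrite /lin big1 // => i _; by rewrite mxE mul0r.
have fx : ceval f x = 0 by apply: hfp.
set u := lin rc Bi (x 0) in u0 *; set vv := lin rc Bi (v 0).
pose v' := v - (vv ord0 / u ord0) *: x.
have vE : v = v' + (vv ord0 / u ord0) *: x by rewrite subrK.
have xs g j : g \is j.-homog -> ceval g x = 0 -> dirder g x v = dirder g x v'.
  by move=> hg gx; rewrite vE dirderD dirderZ (euler _ hg) gx !mulr0 addr0.
rewrite (xs _ _ hf fx); rewrite (xs _ _ p_homog px) in pv.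
have [G GE] := plane_poly_dvd hfp.
set w := lin rc Bi (v' 0).
have w0 : w ord0 = 0.
  rewrite /w (@eq_lin _ _ _ _ _ _ (fun i => v 0 i + - (vv ord0 / u ord0) * x 0 i)).
    rewrite /lin; under eq_bigr do rewrite mulrDl -mulrA; rewrite big_split -mulr_sumr /=.
    by rewrite -/(lin rc Bi (v 0) ord0) -/(lin rc Bi (x 0) ord0) mulNr divfK // subrr.
  by move=> i; rewrite !mxE mulNr.
pose S1 := (u (lift ord0 ord0) / u ord0)%:P + (w (lift ord0 ord0) / u ord0)%:P * 'X : {poly C}.
pose S2 := (u ord_max / u ord0)%:P + (w ord_max / u ord0)%:P * 'X : {poly C}.
have clE g j : g \is j.-homog ->
    cline g x v' = (u ord0)%:P ^+ j * ev2 (polyC \o rc) S1 S2 (plane_poly B g).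
  move=> hg; rewrite ev2_plane_poly -(mmap_homogZ _ _ _ hg); apply: eq_mmap => // i.
  rewrite -lin_scale.
  have xE : x 0 i = lin rc B u i by rewrite linK.
  have vE' : v' 0 i = lin rc B w i by rewrite linK.
  rewrite xE vE' /lin !sum3 /triple /= w0 mul0r add0r /S1 /S2 mulr1.
  rewrite /= !polyCD !polyCM.
  have uu : (u ord0)%:P * (u ord0)^-1%:P = 1 :> {poly C} by rewrite -polyCM mulfV.
  set A0 := (u ord0)%:P in uu *; set A1 := (u (lift _ _))%:P; set A2 := (u ord_max)%:P.
  set V := (u ord0)^-1%:P in uu *; set W1 := (w (lift _ _))%:P; set W2 := (w ord_max)%:P.
  set b0 := (rc _)%:P; set b1 := (rc _)%:P; set b2 := (rc _)%:P.
  transitivity (A0 * b0 + (A0 * V) * (A1 * b1 + A2 * b2 + (W1 * b1 + W2 * b2) * 'X)).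
    by rewrite uu; ring.
  by ring.
pose Q := ev2 (polyC \o rc) S1 S2 (plane_poly B p).
have pE := clE _ _ p_homog; have fE := clE _ _ hf.
rewrite -rmorphXn /= -/Q in pE.
rewrite -rmorphXn GE (rmorphM (ev2 (polyC \o rc) S1 S2)) -/Q in fE.
set T := ev2 _ _ _ G in fE.
have ud0 j : u ord0 ^+ j != 0 by rewrite expf_neq0.
have Q0 : Q.[0] = 0.
  have : (cline p x v').[0] = 0 by rewrite horner_cline scale0r addr0; exact: px.
  by rewrite pE hornerM hornerC => /eqP; rewrite mulf_eq0 (negPf (ud0 d)) => /eqP.
have Q1 : Q^`().[0] = 0.
  have : (cline p x v')^`().[0] = 0 by rewrite horner_deriv_cline scale0r addr0; exact: pv.
  rewrite pE derivM derivC mul0r add0r hornerM hornerC => /eqP.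
  by rewrite mulf_eq0 (negPf (ud0 d)) => /eqP.
have <- : (cline f x v')^`().[0] = dirder f x v' by rewrite horner_deriv_cline scale0r addr0.
rewrite fE derivM /= derivC mul0r add0r derivM hornerM hornerD !hornerM Q0 Q1 !mulr0 addr0.
by rewrite mulr0.
Qed.

End Nullstellensatz.

(** * Regular points and tangent lines of the curve *)

Section TangentSpaces.
Variables (R : realType) (p : {mpoly R[3]}) (d : nat) (w : 'rV[R]_3).
Local Notation C := R[i].
Local Notation rc := (real_complex R).
Hypotheses (p_irr : irreducible_mpoly p) (p_homog : p \is d.-homog).
Hypothesis pw0 : p.@[w 0] != 0.

Lemma lin_mul (M N : 'M[R]_3) (u : 'I_3 -> C) i :
  lin rc (M *m N) u i = lin rc N (lin rc M u) i.
Proof.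
rewrite /lin; under [RHS]eq_bigr do rewrite mulr_suml.
rewrite exchange_big; apply: eq_bigr => j _; rewrite mxE rmorph_sum mulr_sumr.
by apply: eq_bigr => k _; rewrite rmorphM mulrA.
Qed.

Lemma base_neq0 : w != 0.
Proof.
apply: contraNneq pw0 => w0; rewrite -(rc_eq0 p.@[w 0]) -ceval_real w0 map_mx0.
by rewrite -(scale0r 0) (ceval_homogZ _ _ p_homog) expr0n gtn_eqF ?(irreducible_homog_pos p_irr p_homog) // mul0r.
Qed.

(** Two charts suffice: if the first two frame coordinates of x vanish, x is a multiple of w, where
    p is nonzero. The second chart is the first one after exchanging these coordinates. *)
Lemma tangent_vanishing f (x v : 'rV[C]_3) : homogeneous f ->
  (forall x : 'rV[C]_3, x != 0 -> ceval p x = 0 -> ceval f x = 0) ->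
  x != 0 -> ceval p x = 0 -> dirder p x v = 0 -> dirder f x v = 0.
Proof.
move=> [k hf] hfp x0 px pv.
have [B [Bi [BBi BiB rB]]] := frame_exists base_neq0.
have pB : p.@[B ord_max] != 0.
  rewrite (_ : p.@[B ord_max] = p.@[w 0]) //; apply: eq_mmap => // i.
  by rewrite -rB mxE.
have [u0|u0] := eqVneq (lin rc Bi (x 0) ord0) 0; last first.
  exact: (tangent_vanishing_chart BiB BBi p_irr p_homog pB hf hfp u0 px pv).
have [u1|u1] := eqVneq (lin rc Bi (x 0) (lift ord0 ord0)) 0.
  exfalso; set u2 := lin rc Bi (x 0) ord_max.
  have xE : x = u2 *: cvec w.
    apply/rowP => i; rewrite -(linK rc (x 0) i BiB) /lin sum3 -!/(lin rc Bi (x 0) _).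
    by rewrite u0 u1 !mul0r !add0r -/u2 !mxE -rB mxE.
  move/eqP: px; rewrite xE (ceval_homogZ _ _ p_homog) mulf_eq0 ceval_real rc_eq0 (negPf pw0) orbF.
  rewrite expf_eq0 => /andP[_ /eqP u20].
  by move: x0; rewrite xE u20 scale0r eqxx.
pose T : 'M[R]_3 := tperm_mx ord0 (lift ord0 ord0).
have TT : T *m T = 1%:M by rewrite -perm_mxM tperm2 perm_mx1.
have BBi' : T *m B *m (Bi *m T) = 1%:M by rewrite mulmxA -(mulmxA T) BBi mulmx1.
have BiB' : Bi *m T *m (T *m B) = 1%:M by rewrite mulmxA -(mulmxA Bi) TT mulmx1.
have pB' : p.@[(T *m B) ord_max] != 0.
  rewrite (_ : p.@[(T *m B) ord_max] = p.@[B ord_max]) //; apply: eq_mmap => // i.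
  by rewrite -row_permE mxE tpermD.
apply: (tangent_vanishing_chart BiB' BBi' p_irr p_homog pB' hf hfp _ px pv).
rewrite lin_mul /lin sum3 -/(lin _ _ _ _) !mxE tpermL.
by rewrite u0 mul0r add0r tpermR tpermD //= !mulr1 mulr0 addr0.
Qed.

Definition grad f (x : 'rV[C]_3) : 'rV[C]_3 := \row_i ceval f^`M(i) x.

Lemma pairing_grad f x v : pairing (grad f x) v = dirder f x v.
Proof. by apply: eq_bigr => i _; rewrite mxE. Qed.

Local Notation X := (proj_zeros [set p]).

Lemma proj_zerosP x : X x <-> x != 0 /\ ceval p x = 0.
Proof.
split=> [[x0 h]|[x0 px]]; split; [exact: x0|exact: (h p (erefl p))|exact: x0|].
by move=> f ->; exact: px.
Qed.

Lemma tangent_spaceE x : X x -> tangent_space X x = [set v | pairing (grad p x) v = 0].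
Proof.
move=> /proj_zerosP[x0 px]; apply/seteqP; split=> v /= h.
  rewrite pairing_grad; apply: h; split; first by exists d.
  by move=> y /proj_zerosP[].
move=> f [hf fX]; rewrite pairing_grad in h.
have hX y : y != 0 -> ceval p y = 0 -> ceval f y = 0.
  by move=> y0 py; apply: fX; apply/proj_zerosP; split; [exact: y0|exact: py].
exact: (tangent_vanishing hf hX x0 px h).
Qed.

Lemma kernel_dim (g : 'rV[C]_3) : exists2 U : {vspace 'rV[C]_3},
  [set v | pairing g v = 0] = [set` U] & \dim U = (3 - (g != 0%R))%N.
Proof.
pose F : 'Hom('rV[C]_3, 'rV[C]_1) := linfun (mulmxr g^T).
have FE v : F v = (pairing g v)%:M.
  rewrite lfunE /=; apply/rowP => i; rewrite ord1 !mxE /=.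
  by apply: eq_bigr => j _; rewrite mxE mulrC.
exists (lker F).
  apply/seteqP; split=> v /=; rewrite memv_ker FE.
    by move=> ->; rewrite -scalemx1 scale0r.
  by move=> /eqP /matrixP /(_ 0 0); rewrite !mxE mulr1n.
have := limg_ker_dim F fullv; rewrite capfv dimvf.
have -> : \dim (limg F) = (g != 0%R).
  have [g0|g0] := eqVneq g 0.
    apply/eqP; rewrite dimv_eq0 -subv0; apply/subvP => _ /memv_imgP[v _ ->].
    rewrite FE g0 memv0 /pairing big1 ?raddf0 // => i _.
    by rewrite mxE mul0r.
  apply/eqP; rewrite eqn_leq; apply/andP; split.
    by apply: leq_trans (dimvS (subvf _)) _; rewrite dimvf.
  rewrite lt0n dimv_eq0; apply: contra g0 => /eqP L0.
  apply/eqP/rowP => i; rewrite mxE.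
  have : F (delta_mx 0 i) \in limg F by rewrite memv_img ?memvf.
  rewrite L0 memv0 FE => /eqP /matrixP /(_ 0 0); rewrite !mxE mulr1n /pairing (bigD1 i) //=.
  rewrite mxE !eqxx mulr1 big1 ?addr0 // => j ji.
  by rewrite mxE (negPf ji) mulr0.
move=> E; exact: (canRL (addnK _) (E : (\dim (lker F) + (g != 0%R) = 3)%N)).
Qed.

Hypothesis smooth_pt : exists2 y, X y & grad p y != 0.

(** Tangent spaces have dimension 2 or 3 according to whether the gradient is nonzero, and
    [smooth_pt] ensures that the minimum is 2. *)
Lemma regular_pointE x : regular_point X x <-> X x /\ grad p x != 0.
Proof.
split=> [[Xx [U UE Umin]]|[Xx gx]].
  split; first exact: Xx.
  have [y Xy gy] := smooth_pt.
  have [V VE Vd] := kernel_dim (grad p y).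
  have := Umin y V Xy; rewrite (tangent_spaceE Xy) => /(_ VE).
  have [W WE Wd] := kernel_dim (grad p x).
  have -> : U = W.
    apply/vspaceP => v; have : [set` U] v <-> [set` W] v by rewrite -UE -WE (tangent_spaceE Xx).
    by move=> /= h; apply/idP/idP => /h.
  by rewrite Vd gy Wd; case: (grad p x != 0).
split; first exact: Xx.
have [U UE Ud] := kernel_dim (grad p x).
exists U; first by rewrite (tangent_spaceE Xx).
move=> y V Xy VE.
have [W WE Wd] := kernel_dim (grad p y).
have -> : V = W.
  apply/vspaceP => v; have : [set` V] v <-> [set` W] v by rewrite -VE -WE (tangent_spaceE Xy).
  by move=> /= h; apply/idP/idP => /h.
by rewrite Ud Wd gx; case: (grad p y != 0).
Qed.

Lemma kernel_sub_proportional (g l : 'rV[C]_3) : g != 0 ->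
  (forall v, pairing g v = 0 -> pairing l v = 0) -> exists k, l = k *: g.
Proof.
move=> g0 h; have [j gj] : exists j, g 0 j != 0.
  apply/existsP; apply: contraR g0 => /existsPn gz; apply/eqP/rowP => i.
  by rewrite mxE; apply/eqP; move: (gz i); rewrite negbK.
have pd (m : 'rV[C]_3) i : pairing m (delta_mx 0 i) = m 0 i.
  rewrite /pairing (bigD1 i) //= mxE !eqxx mulr1 big1 ?addr0 // => k ki.
  by rewrite mxE (negPf ki) mulr0.
have pl (m u v : 'rV[C]_3) a b : pairing m (a *: u - b *: v) = a * pairing m u - b * pairing m v.
  rewrite /pairing !mulr_sumr -sumrB; apply: eq_bigr => k _; rewrite !mxE; ring.
exists (l 0 j / g 0 j); apply/rowP => i; rewrite mxE.
have := h (g 0 j *: delta_mx 0 i - g 0 i *: delta_mx 0 j).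
rewrite !pl !pd mulrC subrr => /(_ erefl) /eqP; rewrite subr_eq0 => /eqP E.
by apply: (mulfI gj); rewrite E mulrCA mulrA divfK // mulrC.
Qed.

(* The set whose Zariski closure is dual_variety. *)
Definition tangent_lines : set 'rV[C]_3 :=
  [set l | l != 0 /\ exists2 x, regular_point X x & tangent_space X x `<=` hyperplane l].

Lemma tangent_linesP l : tangent_lines l <->
  l != 0 /\ exists x k, [/\ X x, grad p x != 0 & l = k *: grad p x].
Proof.
split=> [[l0 [x]]|[l0 [x [k [Xx gx lE]]]]].
  move=> /regular_pointE[Xx gx]; rewrite (tangent_spaceE Xx) => h.
  by have [k lE] := kernel_sub_proportional gx h; split; [exact: l0|exists x, k].
split; first exact: l0.
exists x; first by apply/regular_pointE.
rewrite (tangent_spaceE Xx) => v /= gv; rewrite /hyperplane /= lE.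
transitivity (k * pairing (grad p x) v); last by rewrite gv mulr0.
by rewrite /pairing mulr_sumr; apply: eq_bigr => i _; rewrite mxE mulrA.
Qed.

Lemma smooth_tangent x : X x -> grad p x != 0 -> tangent_lines (grad p x).
Proof.
by move=> Xx gx; apply/tangent_linesP; split=> //; exists x, 1; rewrite scale1r.
Qed.

(** The zero vector lies in no projective set; it enters the affine cone through the scalar 0, for
    which the closure has to be nonempty. *)
Lemma real_dualE (a : 'rV[R]_3) :
  real_points (affine_cone (dual_variety X)) a <->
  forall f, vanishing tangent_lines f -> ceval f (cvec a) = 0.
Proof.
have [y Xy gy] := smooth_pt.
have Tg := smooth_tangent Xy gy.
split.
  move=> [k [l [cl aE]]] f [[j hf] fT].
  have := cl (proj_zeros (vanishing tangent_lines)).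
  have zc : zariski_closed (proj_zeros (vanishing tangent_lines)).
    by exists (vanishing tangent_lines) => // g [].
  have sub : tangent_lines `<=` proj_zeros (vanishing tangent_lines).
    by move=> m Tm; split; [exact: Tm.1|move=> g [_]; apply].
  move=> /(_ (conj zc sub)) [_ /(_ f)].
  rewrite -/(vanishing _) => /(_ (conj (ex_intro _ j hf) fT)) fl.
  by rewrite aE (ceval_homogZ _ _ hf) fl mulr0.
move=> h.
have [a0|a0] := eqVneq a 0.
  exists 0, (grad p y); rewrite scale0r a0 map_mx0; split=> //.
  by move=> A [_]; apply.
exists 1, (cvec a); rewrite scale1r; split=> //.
move=> A [[F hF ->] TA]; split.
  by apply: contra_neq a0 => /rowP a0; apply/rowP => i; move: (a0 i); rewrite !mxE => -[].
move=> f Ff; apply: h; split; first exact: hF.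
by move=> l /TA[_]; apply.
Qed.

End TangentSpaces.

(** * Generic lines through a point off the curve *)

Section GenericLines.
Variables (R : realType).
Local Notation C := R[i].
Local Notation rc := (real_complex R).

Lemma root_isolated (f : {poly C}) (z0 : C) : f != 0 ->
  exists2 delta : R, 0 < delta & forall z, 0 < `|z - z0| < rc delta -> f.[z] != 0.
Proof.
move=> f0.
(* z0 may itself be a root; the value 1 there is a dummy that keeps the function positive. *)
have [|delta d0 hd] := @root_lbound R f
    (fun z => if z == z0 then 1 else complex.Re `|z - z0|) f0.
  move=> z _; case: eqP => [_|/eqP zz]; first exact: ltr01.
  have /gt0_complexP[r r0 ->] : 0 < `|z - z0| by rewrite normr_gt0 subr_eq0.
  exact: r0.
exists delta => // z /andP[zz zd]; apply/negP => rz; have := hd z rz.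
have /negPf -> : z != z0 by rewrite -subr_eq0 -normr_gt0.
have [r r0 rE] := gt0_complexP zz.
by rewrite leNgt -ltcR; move: zd; rewrite rE => ->.
Qed.

Variables (p : {mpoly R[3]}) (d : nat) (e : 'rV[R]_3).
Hypotheses (p_irr : irreducible_mpoly p) (p_homog : p \is d.-homog).

(** Homogeneity of degree d - 1 of the derivatives, multiplied by k to avoid a truncated
    exponent. *)
Lemma dirder_homogZ k (x v : 'rV[C]_3) :
  k * dirder p (k *: x) v = k ^+ d * dirder p x v.
Proof.
rewrite -dirderZ.
have h1 : (cline p (k *: x) (k *: v))^`().[0] = dirder p (k *: x) (k *: v).
  by rewrite horner_deriv_cline scale0r addr0.
have h2 : (cline p x v)^`().[0] = dirder p x v.
  by rewrite horner_deriv_cline scale0r addr0.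
rewrite -h1 -h2.
have -> : cline p (k *: x) (k *: v) = (k ^+ d)%:P * cline p x v.
  rewrite rmorphXn -(mmap_homogZ _ _ _ p_homog); apply: eq_mmap => // i.
  by rewrite !mxE !polyCM mulrDr mulrA.
by rewrite derivM derivC mul0r add0r hornerM hornerC.
Qed.

Section Frame.
Variables (B Bi : 'M[R]_3).
Hypotheses (BiB : Bi *m B = 1%:M) (BBi : B *m Bi = 1%:M).

Lemma deriv_plane_poly f s y :
  ev2 rc s y (plane_poly B f)^`() =
  dirder f (frame_pt B (triple 1 s y)) (cvec (row ord_max B)).
Proof.
have <- : (cline f (frame_pt B (triple 1 s y)) (cvec (row ord_max B)))^`().[0] =
   dirder f (frame_pt B (triple 1 s y)) (cvec (row ord_max B)).
  by rewrite horner_deriv_cline scale0r addr0.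
have -> : cline f (frame_pt B (triple 1 s y)) (cvec (row ord_max B)) =
   map_poly (eval_coefs s) (plane_poly B f) \Po ('X + y%:P).
  rewrite -[RHS](_ : ev2 (polyC \o rc) s%:P ('X + y%:P) (plane_poly B f) = _).
    rewrite ev2_plane_poly; apply: eq_mmap => // i.
    rewrite !mxE /lin !sum3 /triple /= !polyCD !polyCM mulrDl; ring.
  rewrite ev2E /comp_poly; congr (_.[_]).
  rewrite -map_poly_comp; apply: eq_map_poly => c /=.
  by rewrite /horner_eval (map_poly_comp polyC rc) /= horner_map.
rewrite deriv_comp derivD derivX derivC addr0 mulr1 horner_comp hornerD hornerX hornerC.
by rewrite add0r deriv_map ev2E.
Qed.

Hypothesis pw0 : p.@[B ord_max] != 0.

Lemma separable_line D u v (s : C) y :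
  D%:P = u * plane_poly B p + v * (plane_poly B p)^`() ->
  (map_poly rc D).[s] != 0 ->
  ceval p (frame_pt B (triple 1 s y)) = 0 ->
  dirder p (frame_pt B (triple 1 s y)) (cvec (row ord_max B)) != 0.
Proof.
move=> E Ds py; apply: contra Ds => /eqP dy.
have : ev2 rc s y D%:P = 0.
  rewrite E (rmorphD (ev2 rc s y)) !(rmorphM (ev2 rc s y)) -ceval_plane_poly py.
  by rewrite deriv_plane_poly dy !mulr0 addr0.
by rewrite ev2_polyC => ->.
Qed.

End Frame.

Hypothesis pe0 : p.@[e 0] != 0.

(** In a frame with last row e, the line through e and a + v is a fiber s = const of the projection
    from e. It suffices to move s away from the finitely many zeros of D, after making the first
    coordinate of a nonzero. *)
Lemma generic_perturbation (a : 'rV[R]_3) (eta : R) : 0 < eta ->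
  exists2 v : 'rV[R]_3, (forall i, `|v 0 i| < eta) & forall z : C,
    z *: cvec e - cvec (a + v) != 0 /\
    (ceval p (z *: cvec e - cvec (a + v)) = 0 ->
     dirder p (z *: cvec e - cvec (a + v)) (cvec e) != 0).
Proof.
move=> eta0.
have [B [Bi [BBi BiB rB]]] := frame_exists (base_neq0 p_irr p_homog pe0).
have pB : p.@[B ord_max] != 0.
  rewrite (_ : p.@[B ord_max] = p.@[e 0]) //; apply: eq_mmap => // i.
  by rewrite -rB mxE.
have [D [u [v [D0 DE]]]] := discriminant BiB BBi p_irr p_homog pB.
pose al := lin idfun Bi (a 0).
pose M : R := 1 + \sum_i (`|B ord0 i| + `|B (lift ord0 ord0) i|).
have Mge i : `|B ord0 i| + `|B (lift ord0 ord0) i| < M.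
  by rewrite /M (bigD1 i) //= ltr_pwDl // lerDl sumr_ge0 // => j _; rewrite addr_ge0.
have M0 : 0 < M by rewrite ltr_pwDl // sumr_ge0 // => j _; rewrite addr_ge0.
have em0 : 0 < eta / M by rewrite divr_gt0.
pose mu1 : R := if al ord0 == 0 then eta / M / 2 else 0.
have mu1s : `|mu1| < eta / M.
  rewrite /mu1; case: eqP => _; last by rewrite normr0.
  by rewrite gtr0_norm ?divr_gt0 // half_lt.
pose c0 := al ord0 + mu1.
have c00 : c0 != 0.
  by rewrite /c0 /mu1; case: (al ord0 =P 0) => [->|/eqP h]; rewrite ?add0r ?addr0 // gt_eqF // divr_gt0.
(* The fiber of the unperturbed second coordinate; adding [mu2] to that coordinate moves it to t0 +
   mu2 / c0, within the radius around t0 on which D has no other zero. *)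
pose t0 := al (lift ord0 ord0) / c0.
have Dc0 : map_poly rc D != 0 by rewrite map_poly_eq0.
have [dl dl0 hdl] := root_isolated (rc t0) Dc0.
pose mm := Num.min (eta / M) (dl * `|c0|).
have mm0 : 0 < mm by rewrite lt_min em0 mulr_gt0 // normr_gt0.
pose mu2 := mm / 2.
have mu20 : 0 < mu2 by rewrite divr_gt0.
have mu2m : mu2 < mm by apply: half_lt.
have mu2s : `|mu2| < eta / M.
  by rewrite gtr0_norm // (lt_le_trans mu2m) // ge_min lexx.
have Ds : (map_poly rc D).[rc (t0 + mu2 / c0)] != 0.
  apply: hdl; rewrite -rmorphB addrAC subrr add0r norm_rc rc_gt0 ltcR.
  have mu2n : mu2 != 0 by rewrite gt_eqF.
  rewrite normr_gt0 (mulf_neq0 mu2n) ?invr_eq0 //=.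
  rewrite normrM normfV ltr_pdivrMr ?normr_gt0 // gtr0_norm //.
  by rewrite (lt_le_trans mu2m) // ge_min lexx orbT.
pose vv : 'rV[R]_3 := mu1 *: row ord0 B + mu2 *: row (lift ord0 ord0) B.
exists vv; [move=> i|move=> z].
  rewrite !mxE.
  apply: le_lt_trans (ler_normD _ _) _; rewrite (normrM mu1) (normrM mu2).
  apply: le_lt_trans (_ : eta / M * (`|B ord0 i| + `|B (lift ord0 ord0) i|) < _).
    by rewrite mulrDr; apply: lerD; apply: ler_wpM2r; rewrite ?normr_ge0 ?(ltW mu1s) ?(ltW mu2s).
  rewrite mulrAC ltr_pdivrMr // ltr_pM2l //; exact: Mge.
pose y := (z - rc (al ord_max)) / - rc c0.
have rc0 : - rc c0 != 0 by rewrite oppr_eq0 rc_eq0.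
have xE : z *: cvec e - cvec (a + vv) = - rc c0 *: frame_pt B (triple 1 (rc (t0 + mu2 / c0)) y).
  apply/rowP => i; rewrite !mxE -rB -[a 0 i](linK idfun (a 0) i BiB).
  rewrite -/al /lin !sum3 /triple /= !mxE.
  have E1 : rc c0 * rc (t0 + mu2 / c0) = rc (al (lift ord0 ord0) + mu2).
    by rewrite -rmorphM /t0 -mulrDl [c0 * _]mulrC divfK.
  have E2 : - rc c0 * y = z - rc (al ord_max) by rewrite /y mulrC divfK.
  set b0 := B ord0 i; set b1 := B (lift _ _) i; set b2 := B ord_max i.
  transitivity (- (rc c0 * rc b0) - rc c0 * rc (t0 + mu2 / c0) * rc b1 + - rc c0 * y * rc b2).
    by rewrite E1 E2 /c0 !(rmorphD, rmorphM) /=; ring.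
  by ring.
rewrite xE; split.
  rewrite scaler_eq0 negb_or rc0; apply: (frame_pt_neq0 BBi (i := ord0)).
  by rewrite /triple /= oner_eq0.
rewrite (ceval_homogZ _ _ p_homog) => /eqP; rewrite mulf_eq0 expf_eq0 (negPf rc0) andbF /=.
move=> /eqP py; have := separable_line DE Ds py; rewrite rB.
apply: contra => /eqP dy; have := dirder_homogZ (- rc c0) (frame_pt B (triple 1 (rc (t0 + mu2 / c0)) y)) (cvec e).
by rewrite dy mulr0 => /esym/eqP; rewrite mulf_eq0 expf_eq0 (negPf rc0) andbF.
Qed.

(** On a generic line through e, p has positive degree d with leading coefficient p(e), so it has a
    complex zero, and the gradient there is nonzero. *)
Lemma smooth_point_exists : exists2 y, proj_zeros [set p] y & grad p y != 0.
Proof.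
have [v _ hv] := generic_perturbation 0 ltr01.
have [sz lc] := cline_coef (- cvec (0 + v)) (cvec e) p_homog.
have [z rz] : exists z, root (cline p (- cvec (0 + v)) (cvec e)) z.
  apply/closed_rootP; apply/eqP => s1; have := lc; rewrite nth_default.
    by move/esym/eqP; rewrite ceval_real rc_eq0 (negPf pe0).
  by rewrite s1 (irreducible_homog_pos p_irr p_homog).
have [x0 hz] := hv z.
have px : ceval p (z *: cvec e - cvec (0 + v)) = 0.
  by move/rootP: rz; rewrite horner_cline addrC.
exists (z *: cvec e - cvec (0 + v)); first by apply/proj_zerosP.
apply: contra (hz px) => /eqP g0; rewrite -pairing_grad g0 /pairing.
by rewrite big1 // => i _; rewrite mxE mul0r.
Qed.

End GenericLines.

(** * Resultants and specialization *)

Section Elimination.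

Lemma not_coprime_root (K : closedFieldType) (f g : {poly K}) :
  ~~ coprimep f g -> exists y, f.[y] = 0 /\ g.[y] = 0.
Proof.
rewrite /coprimep => /closed_rootP[y]; rewrite root_gcd => /andP[/rootP fy /rootP gy].
by exists y.
Qed.

(** r is the resultant of P and G' = X^j P + G rather than G. As G' has the leading coefficient of
    P, the resultant commutes with every specialization that preserves this coefficient, even if the
    degree of G drops. Common zeros with P are the same for G and G'. *)
Lemma elimination (A : idomainType) (P G : {poly {poly A}}) : (1 < size P)%N ->
  exists r u v, r%:P = u * P + v * G /\
    forall (K : fieldType) (phi : {rmorphism {poly A} -> K}),
      phi (lead_coef P) != 0 -> phi r = 0 ->
      ~~ coprimep (map_poly phi P) (map_poly phi G).
Proof.
move=> sP; pose j := size G; pose G' := 'X^j * P + G.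
have P0 : P != 0 by rewrite -size_poly_gt0 ltnW.
have sXP : size ('X^j * P) = (j + size P)%N.
  by rewrite mulrC size_mulXn.
have ltG : (size G < size ('X^j * P)%R)%N.
  by rewrite sXP -/j -[X in (X < _)%N]addn0 ltn_add2l ltnW.
have sG' : size G' = (j + size P)%N by rewrite size_polyDl.
have lG' : lead_coef G' = lead_coef P.
  by rewrite lead_coefDl // lead_coefM lead_coefXn mul1r.
have s1G' : (1 < size G')%N by rewrite sG' (leq_trans sP) // leq_addl.
have [[u v] /= _ E] := resultant_in_ideal sP s1G'.
exists (resultant P G'), (u + v * 'X^j), v; split.
  by rewrite E /G' mulrDr mulrDl !mulrA addrA.
move=> K phi lc /eqP; rewrite map_resultant ?lG' // resultant_eq0.
apply: contraTN; rewrite /coprimep -leqNgt => cop.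
have : coprimep (map_poly phi P) (map_poly phi 'X^j * map_poly phi P + map_poly phi G).
  by rewrite coprimep_addl_mul.
by rewrite /coprimep /G' rmorphD rmorphM /= => /eqP ->.
Qed.

Lemma ev2_00 (R S : comNzRingType) (iS : {rmorphism R -> S}) (g : {poly {poly R}}) :
  ev2 iS 0 0 g = iS (g`_0).[0].
Proof.
rewrite ev2E [LHS]horner_coef0 coef_map /= /horner_eval !horner_coef0.
by rewrite coef_map.
Qed.

(** As long as all coefficients vanish at 0, one more factor X can be taken out; each time the
    leading coefficient loses a degree. *)
Lemma divide_inner_X (R : idomainType) (r : {poly {poly R}}) : r != 0 ->
  exists j g, r = ('X ^+ j)%:P * g /\ exists k, (g`_k).[0] != 0.
Proof.
have [n] := ubnP (size (lead_coef r)); elim: n r => // n IH r sn r0.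
have [h|h] := pselect (exists k, (r`_k).[0] != 0).
  by exists 0%N, r; rewrite expr0 mul1r.
have /choice[g0 g0E] : forall k, exists c, r`_k = 'X * c.
  move=> k; have /factor_theorem[c cE] : root r`_k 0.
    by apply/rootP/eqP; apply: contrapT => /negP h'; apply: h; exists k.
  by exists c; rewrite cE polyC0 subr0 mulrC.
pose g := \poly_(k < size r) g0 k.
have rE : r = ('X)%:P * g.
  apply/polyP => k; rewrite coefCM coef_poly; case: ltnP => ks; first by rewrite -g0E.
  by rewrite nth_default // mulr0.
have g_0 : g != 0 by apply: contraNneq r0 => g_0; rewrite rE g_0 mulr0.
have [|//|j [g' [gE hg']]] := IH g.
  rewrite -ltnS; apply: leq_trans sn; rewrite [in lead_coef r]rE lead_coefM lead_coefC.
  by rewrite mulrC size_mulX ?lead_coef_eq0.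
by exists j.+1, g'; split=> //; rewrite rE gE mulrA -rmorphM -exprS.
Qed.

End Elimination.

(** * Separating a form from the dual curve *)

Section Contact.
Variables (R : realType) (p : {mpoly R[3]}) (d : nat) (e : 'rV[R]_3).
Local Notation C := R[i].
Local Notation rc := (real_complex R).
Hypotheses (p_irr : irreducible_mpoly p) (p_homog : p \is d.-homog).
Hypothesis pe0 : ceval p (cvec e) != 0.
Hypothesis p_real : forall (a : 'rV[R]_3) (z : C),
  ceval p (z *: cvec e - cvec a) = 0 -> z \is Num.real.
Variables (B Bi : 'M[R]_3).
Hypotheses (BiB : Bi *m B = 1%:M) (BBi : B *m Bi = 1%:M).
Let v0 := row ord0 B.
Let v1 := row (lift ord0 ord0) B.
Let c := row ord_max B.
Hypothesis hc : inner_cone p e c.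

Let q := plane_poly B p.
Let q1 := q^`().
Let q2 := plane_poly B (dirpoly p v1).
Let pt s y := frame_pt B (triple 1 s y).

Lemma base_value : p.@[B ord_max] != 0.
Proof.
have := inner_cone_neq0 p_homog hc; rewrite ceval_real rc_eq0.
rewrite (_ : p.@[c 0] = p.@[B ord_max]) //; apply: eq_mmap => // i.
by rewrite mxE.
Qed.
Let pB := base_value.

Lemma ev2_q s y : ev2 rc s y q = ceval p (pt s y).
Proof. by rewrite -ceval_plane_poly. Qed.

Lemma ev2_q1 s y : ev2 rc s y q1 = dirder p (pt s y) (cvec c).
Proof. exact: deriv_plane_poly. Qed.

Lemma ev2_q2 s y : ev2 rc s y q2 = dirder p (pt s y) (cvec v1).
Proof. by rewrite -ceval_dirpoly -ceval_plane_poly. Qed.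

Lemma frame_pt_real (t r : R) : exists x : 'rV[R]_3, pt (rc t) (rc r) = cvec x.
Proof.
exists (v0 + t *: v1 + r *: c); apply/rowP => i.
rewrite !mxE /lin sum3 /triple /= mul1r !rmorphD !rmorphM /=; ring.
Qed.

Lemma real_fiber (t : R) y : ceval p (pt (rc t) y) = 0 -> exists r, y = rc r.
Proof.
move=> py; apply: (@real_root_inner _ _ _ _ _ p_homog p_real c (v0 + t *: v1)) => //.
rewrite -py; congr ceval; apply/rowP => i.
rewrite !mxE /lin sum3 /triple /= mul1r !rmorphD !rmorphM /=; ring.
Qed.

Lemma ev2_map_coef (s y t : C) (g : {poly {poly R}}) :
  (map_poly (ev2 rc s t) (map_poly polyC g)).[y] = ev2 rc s y g.
Proof.
rewrite ev2E -map_poly_comp; congr (_.[_]); apply: eq_map_poly => a.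
by rewrite [LHS]ev2_polyC.
Qed.

(** [slope_bound] concerns real points only. It applies to the whole fiber over a real parameter
    because hyperbolicity with respect to c makes all points of that fiber real. *)
Lemma contact_slope : exists2 delta : R, 0 < delta & forall t y,
  ceval p (pt (rc t) y) = 0 ->
  rc delta * `|ev2 rc (rc t) y q2| <= `|ev2 rc (rc t) y q1|.
Proof.
have [dl dl0 hdl] := slope_bound p_homog pe0 p_real v1 hc.
exists dl => // t y py; have [r rE] := real_fiber py.
rewrite ev2_q1 ev2_q2; move: py; rewrite rE; have [x ->] := frame_pt_real t r.
exact: hdl.
Qed.

(* t is minus the inverse slope: the tangent at (s, y) is spanned by row 1 of B minus t^-1
   times its last row.  The constant term in t of the resultant controls all other
   coefficients since |t| is bounded below for real s. *)
Lemma contact_poly : exists2 Psi : {poly {poly R}}, (Psi`_0).[0] != 0 &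
  forall s y t : C, s != 0 -> ceval p (pt s y) = 0 ->
    ev2 rc s y q1 = t * ev2 rc s y q2 -> ev2 rc s t Psi = 0.
Proof.
have [D [u [v [D0 DE]]]] := discriminant BiB BBi p_irr p_homog pB.
have [szq lcq] := plane_poly_size p_homog pB.
pose P : {poly {poly {poly R}}} := map_poly polyC q.
(* The variables from inside out are s, t, y; G is t q2 - q1, and the elimination of y from P and G
   leaves r(s, t). *)
pose G : {poly {poly {poly R}}} := map_poly polyC q2 * 'X%:P - map_poly polyC q1.
have szP : size P = d.+1 by rewrite size_map_polyC.
have sP : (1 < size P)%N by rewrite szP ltnS (irreducible_homog_pos p_irr p_homog).
have lP : lead_coef P = (p.@[B ord_max])%:P%:P.
  by rewrite lead_coef_map_inj ?lcq // => x y /polyC_inj.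
have [r [a [b [rE relim]]]] := elimination G sP.
have GE s y t : (map_poly (ev2 rc s t) G).[y] = t * ev2 rc s y q2 - ev2 rc s y q1.
  rewrite rmorphB rmorphM hornerD hornerN hornerM (ev2_map_coef s y t q2) (ev2_map_coef s y t q1).
  have -> : (map_poly (ev2 rc s t) 'X%:P).[y] = t.
    by rewrite map_polyC hornerC; exact: ev2_y.
  by rewrite mulrC.
have rvan s y t : ceval p (pt s y) = 0 -> ev2 rc s y q1 = t * ev2 rc s y q2 ->
    ev2 rc s t r = 0.
  move=> py h; have : (map_poly (ev2 rc s t) r%:P).[y] = ev2 rc s t r.
    by rewrite map_polyC hornerC.
  rewrite rE rmorphD !rmorphM /= hornerD !hornerM GE h subrr mulr0 addr0.
  by rewrite ev2_map_coef ev2_q py mulr0.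
have [dl dl0 hdl] := contact_slope.
have Dc0 : map_poly rc D != 0 by rewrite map_poly_eq0.
have [d2 d20 hd2] := root_isolated 0 Dc0.
(* Here [t] is a value of s and [x] one of t. A zero of r yields a common zero y; there q1 is
   nonzero, as D is nonzero on this fiber, and q1 = x q2 with |x| < dl violates the slope bound. *)
have rnz (t : R) (x : C) : 0 < t < d2 -> `|x| < rc dl -> ev2 rc (rc t) x r != 0.
  move=> /andP[t0 td] xs; apply/eqP => r0.
  have Ds : (map_poly rc D).[rc t] != 0.
    by apply: hd2; rewrite subr0 norm_rc rc_gt0 ltcR normr_gt0 gt_eqF // gtr0_norm.
  have lc0 : ev2 rc (rc t) x (lead_coef P) != 0 by rewrite lP ev2_c rc_eq0.
  have [y [Py Gy]] := not_coprime_root (relim _ _ lc0 r0).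
  rewrite ev2_map_coef ev2_q in Py.
  move/eqP: Gy; rewrite GE subr_eq0 => /eqP Gy.
  have q1n : ev2 rc (rc t) y q1 != 0.
    by rewrite ev2_q1; exact: (separable_line DE Ds Py).
  have q2n : ev2 rc (rc t) y q2 != 0.
    by apply: contraNneq q1n => q20; rewrite -Gy q20 mulr0.
  have := hdl t y Py; rewrite -Gy normrM ler_pM2r ?normr_gt0 //.
  by move/le_lt_trans => /(_ _ xs); rewrite ltxx.
have r0 : r != 0.
  have h : 0 < d2 / 2 < d2 by rewrite divr_gt0 //= half_lt.
  have := rnz (d2 / 2) 0 h; rewrite normr0 rc_gt0 => /(_ dl0).
  by apply: contraNneq => ->; rewrite rmorph0.
have [j [Psi [PsiE [k hk]]]] := divide_inner_X r0.
have PE s t : ev2 rc s t r = s ^+ j * ev2 rc s t Psi.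
  rewrite PsiE (rmorphM (ev2 rc s t)); congr (_ * _).
  by rewrite ev2_polyC map_polyXn hornerXn.
exists Psi; last first.
  move=> s y t s0 py h; have := rvan s y t py h; rewrite PE => /eqP.
  by rewrite mulf_eq0 expf_eq0 (negPf s0) andbF => /eqP.
have cdl : 0 < rc dl by rewrite rc_gt0.
have cdl2 : 0 < rc d2 by rewrite rc_gt0.
pose A := (rc dl ^+ k) *: map_poly rc Psi`_k.
(* k is the index of a coefficient that is nonzero at s = 0. If the constant coefficient vanished
   there, the limit of this inequality at 0 would make the k-th one vanish too. *)
have key x : 0 < x < rc d2 -> `|A.[x]| <= 2 ^+ size Psi * `|(map_poly rc Psi`_0).[x]|.
  move=> /andP[/gt0_complexP[t t0 ->]]; rewrite ltcR => td.
  pose f := map_poly (eval_coefs (rc t)) Psi.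
  have hf z : root f z -> rc dl <= `|z|.
    move=> fz; rewrite real_leNgt ?(gtr0_real cdl) ?normr_real //; apply/negP => zs.
    have tt : 0 < t < d2 by rewrite t0.
    have := rnz t z tt zs; rewrite PE [ev2 _ _ _ Psi](rootP fz).
    by rewrite mulr0 eqxx.
  have := coef_le_coef0 cdl hf k; rewrite !coef_map /= /horner_eval /A hornerZ normrM.
  rewrite normrX (gtr0_norm cdl) mulrC => h; apply: le_trans h _.
  by rewrite ler_wpM2r // ler_weXn2l ?ler1n // size_poly.
have K0 : 0 <= 2 ^+ size Psi :> C by rewrite exprn_ge0.
have := horner0_le K0 cdl2 key.
have rc00 (g : {poly R}) : (map_poly rc g).[0] = rc g.[0].
  by rewrite -[X in _.[X]]/(rc 0) horner_map.
rewrite hornerZ !rc00 => h; apply: contraNneq hk => P0.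
move: h; rewrite P0 normr0 mulr0 normr_le0 mulf_eq0 expf_eq0 rc_eq0 gt_eqF // andbF /=.
by rewrite rc_eq0.
Qed.

End Contact.

Section Separation.
Variables (R : realType) (p : {mpoly R[3]}) (d : nat) (e : 'rV[R]_3).
Local Notation C := R[i].
Local Notation rc := (real_complex R).
Local Notation T2 := {poly {poly R}}.
Hypotheses (p_irr : irreducible_mpoly p) (p_homog : p \is d.-homog).
Hypothesis pe0 : ceval p (cvec e) != 0.
Hypothesis p_real : forall (a : 'rV[R]_3) (z : C),
  ceval p (z *: cvec e - cvec a) = 0 -> z \is Num.real.

Section Frame.
Variables (B Bi : 'M[R]_3).
Hypotheses (BiB : Bi *m B = 1%:M) (BBi : B *m Bi = 1%:M).
Let v0 := row ord0 B.
Let v1 := row (lift ord0 ord0) B.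
Let c := row ord_max B.
Hypothesis hc : inner_cone p e c.

Let q := plane_poly B p.
Let q1 := q^`().
Let q2 := plane_poly B (dirpoly p v1).
Let pt s y := frame_pt B (triple 1 s y).
Let pB := base_value p_homog hc.

Local Notation cc2 := (@polyC {poly R} \o @polyC R).

(** The value of p at (0, -t, 1), the point at infinity of the line (a : 1 : t). It is also the top
    coefficient in y of p restricted to that line. *)
Definition top_coef : T2 := mmap cc2 (fun i => (B ord_max i)%:P%:P - 'X * (B (lift ord0 ord0) i)%:P%:P) p.

Lemma ev2_top_coef (S : comNzRingType) (iS : {rmorphism R -> S}) a t :
  ev2 iS a t top_coef = mmap iS (fun i => iS (B ord_max i) - t * iS (B (lift ord0 ord0) i)) p.
Proof.
apply: mmap_morph => [x|i]; first exact: ev2_c.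
by rewrite (rmorphB (ev2 iS a t)) (rmorphM (ev2 iS a t)) ev2_y !ev2_c.
Qed.

Lemma ev2_top_coef00 : ev2 idfun 0 0 top_coef = p.@[B ord_max].
Proof. by rewrite ev2_top_coef; apply: eq_mmap => // i; rewrite /= mul0r subr0. Qed.

(* (a : 1 : t) are the coordinates of a line in the basis dual to the rows of B; it contains
   the point (1, s, y) when a + s + y t = 0. *)
Lemma incidence_poly : exists2 F : T2, (F`_0).[0] != 0 &
  forall a s y t : C, a + s + y * t = 0 -> s != 0 -> ceval p (pt s y) = 0 ->
    ev2 rc s y q1 = t * ev2 rc s y q2 -> ev2 rc a t F = 0.
Proof.
have [Psi Psi0 hPsi] := contact_poly p_irr p_homog pe0 p_real BiB BBi hc.
pose cc3 : {rmorphism R -> {poly T2}} := polyC \o (polyC \o polyC).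
(* s = - (a + y t), solved from the incidence relation; the variables from inside out are a, t,
   y. *)
pose sg : {poly T2} := - (('X%:P)%:P + 'X * ('X : T2)%:P).
pose P := ev2 cc3 sg 'X q.
pose G := ev2 cc3 sg ('X : T2)%:P Psi.
pose u i : T2 := (B ord0 i)%:P%:P - 'X%:P * (B (lift ord0 ord0) i)%:P%:P.
have PE : P = mmap cc3 (fun i => (u i)%:P +
   ((B ord_max i)%:P%:P - 'X * (B (lift ord0 ord0) i)%:P%:P)%:P * 'X) p.
  rewrite /P /q ev2_plane_poly; apply: eq_mmap => // i.
  rewrite /lin sum3 /triple /= /u /sg !polyCB !polyCM.
  move: (_ _)%:P%:P%:P (_ _)%:P%:P%:P (_ _)%:P%:P%:P => b0 b1 b2; ring.
have [szP lcP] := mmap_linear_coef cc2 u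
  (fun i => (B ord_max i)%:P%:P - 'X * (B (lift ord0 ord0) i)%:P%:P) p_homog.
rewrite (_ : mmap _ _ _ = P) in szP lcP; last by rewrite PE; apply: eq_mmap.
rewrite -/top_coef in lcP.
have tc0 : top_coef != 0.
  by apply: contraNneq pB => h; rewrite -ev2_top_coef00 h rmorph0.
have szP' : size P = d.+1.
  apply/eqP; rewrite eqn_leq szP ltnNge; apply/negP => /leq_sizeP /(_ d (leqnn _)).
  by rewrite lcP => /eqP; rewrite (negPf tc0).
have lP : lead_coef P = top_coef by rewrite lead_coefE szP'.
have sP : (1 < size P)%N by rewrite szP' ltnS (irreducible_homog_pos p_irr p_homog).
have [r [a [b [rE relim]]]] := elimination G sP.
exists r.
  (* At a = t = 0 the substituted s is 0, so G becomes the nonzero constant Psi(0, 0), which is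
     coprime to anything. *)
  have := relim _ (ev2 idfun 0 0); rewrite lP ev2_top_coef00 => /(_ pB) h.
  rewrite -[_.[0]](ev2_00 idfun); apply/eqP => /h; apply/negP; rewrite negbK.
  pose psi : {rmorphism {poly T2} -> {poly R}} := map_poly (ev2 idfun 0 0).
  have psiPC x : psi x%:P = (ev2 idfun 0 0 x)%:P by rewrite /= map_polyC.
  have psisg : psi sg = 0.
    by rewrite (rmorphN psi) (rmorphD psi) (rmorphM psi) !psiPC ev2_s ev2_y mulr0 addr0 oppr0.
  have psiG : psi G = (Psi`_0).[0]%:P.
    rewrite (ev2_morph (psi := psi) (iT := polyC)) => [|x]; last first.
      by rewrite /= map_polyC; congr polyC; exact: (ev2_c idfun 0 0).
    by rewrite psisg psiPC ev2_y polyC0 ev2_00.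
  have -> : map_poly (ev2 idfun 0 0) G = (Psi`_0).[0]%:P := psiG.
  have : (Psi`_0).[0]%:P %= 1 by rewrite polyC_eqp1.
  by move/(eqp_coprimepr (map_poly (ev2 idfun 0 0) P)) => ->; exact: coprimep1.
move=> al s y t E s0 py h.
pose phi : {rmorphism {poly T2} -> C} := horner_eval y \o map_poly (ev2 rc al t).
have phiC x : phi (cc3 x) = rc x.
  by rewrite /= map_polyC /= /horner_eval hornerC; exact: ev2_c.
have phiX : phi 'X = y by rewrite /= map_polyX /horner_eval hornerX.
have phiA : phi ('X%:P)%:P = al.
  by rewrite /= map_polyC /= /horner_eval hornerC; exact: ev2_s.
have phiT : phi ('X : T2)%:P = t.
  by rewrite /= map_polyC /= /horner_eval hornerC; exact: ev2_y.
have phisg : phi sg = s.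
  rewrite (rmorphN phi) (rmorphD phi) (rmorphM phi) phiA phiX phiT.
  by apply/eqP; rewrite eq_sym -addr_eq0 addrA [s + _]addrC E.
have phir x : phi x%:P = ev2 rc al t x by rewrite /= map_polyC /horner_eval hornerC.
rewrite -phir rE (rmorphD phi) !(rmorphM phi).
have -> : phi P = 0.
  by rewrite (ev2_morph (psi := phi) _ _ _ phiC) phisg phiX ev2_q.
have -> : phi G = 0.
  rewrite (ev2_morph (psi := phi) _ _ _ phiC) phisg phiT.
  exact: hPsi s0 py h.
by rewrite !mulr0 addr0.
Qed.

(** The product of q1 - t q2 over the points of the fiber s = 0 with q1 nonzero. Its value at t = 0
    is the product of these q1. Where q1 = 0, the slope bound gives q2 = 0, so no such point is
    concerned. *)
Lemma fiber0_poly : exists2 L : T2, (L`_0).[0] != 0 &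
  forall a y t : C, ceval p (pt 0 y) = 0 -> ev2 rc 0 y q2 != 0 ->
    ev2 rc 0 y q1 = t * ev2 rc 0 y q2 -> ev2 rc a t L = 0.
Proof.
have [zs qE] := closed_field_poly_normal (map_poly (eval_coefs 0) q).
have q0 : map_poly (eval_coefs 0) q != 0.
  by rewrite -size_poly_gt0 (plane_fiber_size p_homog pB).
have zsP y : ceval p (pt 0 y) = 0 -> y \in zs.
  move=> py; have : root (map_poly (eval_coefs 0) q) y.
    by apply/rootP; exact: (etrans (ev2_q _ _ 0 y) py).
  by rewrite qE rootZ ?lead_coef_eq0 // root_prod_XsubC.
have [dl dl0 hdl] := contact_slope p_homog pe0 p_real hc.
(* All points of this fiber are real, so taking real parts changes nothing and keeps the
   coefficients of the product real. *)
pose val (g : T2) (z : C) : R := ev2 idfun 0 (complex.Re z) g.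
pose fac (z : C) : T2 := (val q1 z)%:P%:P - 'X * (val q2 z)%:P%:P.
exists (\prod_(z <- zs | val q1 z != 0) fac z).
  rewrite -[_.[0]](ev2_00 idfun) rmorph_prod prodf_seq_neq0; apply/allP => z _.
  apply/implyP => z1; rewrite (rmorphB (ev2 idfun 0 0)) (rmorphM (ev2 idfun 0 0)).
  by rewrite ev2_y mul0r subr0 ev2_c.
move=> a y t py y2 h.
have py0 : ceval p (frame_pt B (triple 1 (rc 0) y)) = 0 by exact: py.
have [r rE] := real_fiber p_homog p_real hc py0.
have valE g : ev2 rc 0 y g = rc (val g y).
  rewrite /val (@ev2_morph R R C rc idfun rc 0 (complex.Re y) g (fun=> erefl)) rmorph0.
  by rewrite rE.
have y1 : val q1 y != 0.
  apply: contra y2 => /eqP y1; have := hdl 0 y py0; rewrite !rmorph0 -/q1 -/q2 (valE q1) y1.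
  rewrite rmorph0 normr0 pmulr_rle0 ?rc_gt0 // normr_le0 //.
rewrite rmorph_prod (big_rem y) /=; last exact: zsP.
rewrite y1 [X in X * _](_ : _ = 0) ?mul0r //.
have facE : ev2 rc a t (fac y) = rc (val q1 y) - t * rc (val q2 y).
  by rewrite (rmorphB (ev2 rc a t)) (rmorphM (ev2 rc a t)) ev2_y !ev2_c.
rewrite -(valE q1) -(valE q2) h subrr in facE.
exact: facE.
Qed.

(** The three factors treat contact at infinity, off the line s = 0, and on it. The incidence
    relation between the tangent and its point of contact is Euler's relation divided by the
    derivative along [v1]. *)
Lemma dual_chart_poly : exists2 F : T2, (F`_0).[0] != 0 &
  forall x : 'rV[C]_3, x != 0 -> ceval p x = 0 -> dirder p x (cvec v1) != 0 ->
    ev2 rc (dirder p x (cvec v0) / dirder p x (cvec v1))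
       (dirder p x (cvec c) / dirder p x (cvec v1)) F = 0.
Proof.
have [F F0 hF] := incidence_poly.
have [L L0 hL] := fiber0_poly.
exists (top_coef * F * L).
  rewrite -[_.[0]](ev2_00 idfun) !(rmorphM (ev2 idfun 0 0)) ev2_top_coef00 !ev2_00.
  by rewrite !mulf_neq0.
move=> x x0 px g1.
pose a := dirder p x (cvec v0) / dirder p x (cvec v1).
pose t := dirder p x (cvec c) / dirder p x (cvec v1); rewrite -/a -/t.
rewrite !(rmorphM (ev2 rc a t)).
have [u xE] : exists u, x = frame_pt B u.
  by exists (lin rc Bi (x 0)); rewrite frame_pt_coords.
set u0 := u ord0; set u1 := u (lift ord0 ord0); set u2 := u ord_max.
have xvE : x = u0 *: cvec v0 + u1 *: cvec v1 + u2 *: cvec c.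
  by apply/rowP => i; rewrite xE !mxE /lin sum3.
have inc : u0 * a + u1 + u2 * t = 0.
  have := euler x p_homog; rewrite px mulr0 {2}xvE !dirderD !dirderZ => E.
  by apply: (mulIf g1); rewrite mul0r -[RHS]E !mulrDl -!mulrA !(mulVf g1) !mulr1.
have [u00|u00] := eqVneq u0 0.
  suff -> : ev2 rc a t top_coef = 0 by rewrite !mul0r.
  have u1E : u1 = - (u2 * t) by apply/eqP; rewrite -addr_eq0; move: inc; rewrite u00 mul0r add0r => ->.
  have u2n : u2 != 0.
    apply: contraNneq x0 => u20; rewrite xvE u00 u1E u20 mul0r oppr0 !scale0r !addr0 //.
  have : ceval p x = u2 ^+ d * ev2 rc a t top_coef.
    rewrite ev2_top_coef -(mmap_homogZ _ _ _ p_homog); apply: ceval_mmapE => i.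
    by rewrite xvE u00 u1E !mxE; ring.
  by rewrite px => /esym/eqP; rewrite mulf_eq0 expf_eq0 (negPf u2n) andbF => /eqP.
pose s := u1 / u0; pose y := u2 / u0.
have xs : x = u0 *: pt s y.
  apply/rowP => i; rewrite xE !mxE -lin_scale; apply: eq_lin => j.
  rewrite (tripleE u j) -/u0 -/u1 -/u2 /s /y.
  by case: j => [[|[|[]]]] //= ?; rewrite /triple /= ?mulr1 // mulrC divfK.
have py : ceval p (pt s y) = 0.
  move: px; rewrite xs (ceval_homogZ _ _ p_homog) => /eqP.
  by rewrite mulf_eq0 expf_eq0 (negPf u00) andbF => /eqP.
have dE v : dirder p x v = u0 ^+ d / u0 * dirder p (pt s y) v.
  apply: (mulfI u00); rewrite xs (dirder_homogZ p_homog).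
  by rewrite mulrCA !mulrA divfK // mulrC mulrA divfK.
have ku : u0 ^+ d / u0 != 0 by rewrite mulf_neq0 ?invr_eq0 // expf_neq0.
have h1 : ev2 rc s y q2 != 0.
  by rewrite ev2_q2; apply: contraNneq g1 => h; rewrite dE h mulr0.
have h : ev2 rc s y q1 = t * ev2 rc s y q2.
  rewrite ev2_q1 ev2_q2 /t !dE -mulf_div divff // mul1r divfK //.
  by rewrite -ev2_q2.
have inc' : a + s + y * t = 0.
  have us : u0 * s = u1 by rewrite mulrC divfK.
  have uy : u0 * y = u2 by rewrite mulrC divfK.
  by apply: (mulfI u00); rewrite mulr0 -[RHS]inc !mulrDr us [u0 * (y * t)]mulrA uy.
have [s0|s0] := eqVneq s 0.
  by rewrite s0 in py h h1; rewrite (hL a y t py h1 h) mulr0.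
by rewrite (hF a s y t inc' s0 py h) mulr0 mul0r.
Qed.

End Frame.

(** In the frame c, l and their cross product, l has dual coordinates (0 : |l|^2 : 0), the origin of
    the chart b != 0. The polynomial of this chart is homogenized by b, and one more factor b makes
    it vanish on the tangents outside the chart. *)
Lemma real_dual_separation (c l : 'rV[R]_3) : inner_cone p e c ->
  l != 0 -> c != 0 -> pairing l c = 0 ->
  exists2 f, vanishing (tangent_lines p) f & ceval f (cvec l) != 0.
Proof.
move=> hc l0 c0 lc.
have [B [Bi [BBi BiB rc_B rl_B lB0]]] := orthogonal_frame l0 c0 lc.
have hc' : inner_cone p e (row ord_max B) by rewrite rc_B.
have [F F0 hF] := dual_chart_poly BiB BBi hc'.
pose frm (v : 'rV[R]_3) : {mpoly R[3]} := \sum_i v 0 i *: 'X_i.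
have frm_homog v : frm v \is 1.-homog.
  by apply: rpred_sum => i _; apply: rpredZ; rewrite dhomogX /= mdeg1.
have frmE v m : ceval (frm v) m = pairing m (cvec v).
  rewrite ceval_mmap raddf_sum; apply: eq_bigr => i _.
  by rewrite /= mmapZ mmapX mmap1U mxE mulrC.
pose a := frm (row ord0 B); pose b := frm (row (lift ord0 ord0) B); pose t := frm (row ord_max B).
pose Fh := to_mpoly2 F; pose k := msize Fh.
pose f := b * mhom (@mpolyC 3 R) k Fh b (pair2 a t).
have f_homog : homogeneous f.
  exists (1 + k)%N; apply: dhomogM; first exact: frm_homog.
  apply: mhom_homog; [exact: leqnSn|exact: frm_homog|].
  by move=> [[|[]]] //= ?; exact: frm_homog.
have cevalM g h m : ceval (g * h) m = ceval g m * ceval h m.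
  by rewrite !ceval_mmap rmorphM.
have fE m : ceval b m != 0 ->
    ceval f m = ceval b m ^+ k.+1 * ev2 rc (ceval a m / ceval b m) (ceval t m / ceval b m) F.
  move=> bm; rewrite cevalM exprS -mulrA; congr (_ * _).
  rewrite ceval_mmap (@mhom_morph _ _ _ _ (mmap rc (m 0)) (@mpolyC 3 R) rc _ _ _ _
     (fun i => ceval b m * pair2 (ceval a m / ceval b m) (ceval t m / ceval b m) i)); last 2 first.
  - by move=> x; rewrite /= mmapC.
  - by move=> [[|[]]] //= ?; rewrite /pair2 /= -ceval_mmap mulrC divfK.
  rewrite /= -(ceval_mmap b m) mhomE ?leqnSn //; congr (_ * _); rewrite /Fh /to_mpoly2.
  rewrite (ev2_morph (psi := mmap rc (pair2 (ceval a m / ceval b m) (ceval t m / ceval b m))) (iT := rc)).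
    by rewrite /= !mmapX !mmap1U.
  by move=> x; rewrite /= mmapC.
have peR : p.@[e 0] != 0 by rewrite -rc_eq0 -ceval_real.
have smooth := smooth_point_exists p_irr p_homog peR.
exists f.
  split; first exact: f_homog.
  move=> m /(tangent_linesP p_irr p_homog peR smooth)[m0 [x [kap [/proj_zerosP[x0 px] gx mE]]]].
  have [bm|bm] := eqVneq (ceval b m) 0; first by rewrite cevalM bm mul0r.
  have dE v : ceval (frm v) m = kap * dirder p x (cvec v).
    rewrite frmE mE -pairing_grad /pairing mulr_sumr; apply: eq_bigr => i _.
    by rewrite mxE mulrA.
  have kap0 : kap != 0 by apply: contraNneq m0 => k0; rewrite mE k0 scale0r.
  have g1 : dirder p x (cvec (row (lift ord0 ord0) B)) != 0.
    by apply: contraNneq bm => g1; rewrite dE g1 mulr0.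
  by rewrite fE // !dE -!mulf_div !divff // !mul1r hF // mulr0.
have lE v : ceval (frm v) (cvec l) = rc (pairing l v).
  by rewrite frmE rmorph_sum; apply: eq_bigr => i _; rewrite !mxE rmorphM.
have aE : ceval a (cvec l) = 0 by rewrite lE lB0 rmorph0.
have tE : ceval t (cvec l) = 0 by rewrite lE rc_B lc rmorph0.
have bE : ceval b (cvec l) != 0.
  rewrite lE rl_B rc_eq0 gt_eqF //; have := sum_sqr_gt0 l0.
  by congr (0 < _); apply: eq_bigr => i _; rewrite expr2.
by rewrite fE // aE tE !mul0r ev2_00 mulf_neq0 ?expf_neq0 // rc_eq0.
Qed.

End Separation.

(** * Closed convex cones *)

Section ConeSeparation.
Variables (R : realType).
Implicit Types (S : set 'rV[R]_3) (l s x y e : 'rV[R]_3).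

Lemma pairingC n (x y : 'rV[R]_n) : pairing x y = pairing y x.
Proof. by apply: eq_bigr => i _; rewrite mulrC. Qed.

Lemma pairingDl n (x y z : 'rV[R]_n) : pairing (x + y) z = pairing x z + pairing y z.
Proof. by rewrite /pairing -big_split; apply: eq_bigr => i _; rewrite mxE mulrDl. Qed.

Lemma pairingZl n k (x z : 'rV[R]_n) : pairing (k *: x) z = k * pairing x z.
Proof. by rewrite /pairing mulr_sumr; apply: eq_bigr => i _; rewrite mxE mulrA. Qed.

Lemma pairingDr n (x y z : 'rV[R]_n) : pairing z (x + y) = pairing z x + pairing z y.
Proof. by rewrite !(pairingC z) pairingDl. Qed.

Lemma pairingZr n k (x z : 'rV[R]_n) : pairing z (k *: x) = k * pairing z x.
Proof. by rewrite !(pairingC z) pairingZl. Qed.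

Lemma compact_argmin (T : topologicalType) (A : set T) (f : T -> R) :
  compact A -> A !=set0 -> continuous f ->
  exists2 x : T, A x & forall y : T, A y -> f x <= f y.
Proof.
move=> cA [a0 Aa0] cf.
have cfA : compact (f @` A).
  by apply: continuous_compact => //; exact: continuous_subspaceT.
have fA_cl : closed (f @` A) by apply: compact_closed => //; exact: norm_hausdorff.
have [M [Mr hM]] := compact_bounded cfA.
have hinf : has_inf (f @` A).
  split; first by exists (f a0), a0.
  exists (- (M + 1)) => _ [x Ax <-].
  have M1 : M < M + 1 by rewrite ltrDl.
  have /= := hM (M + 1) M1 (f x) (ex_intro2 _ _ x Ax erefl).
  by rewrite ler_norml => /andP[].
have : (f @` A) (inf (f @` A)).
  apply: fA_cl => U /nbhs_ballP[eps /= eps0 hU].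
  have [y fy yl] := inf_adherent eps0 hinf.
  exists y; split=> //; apply: hU; rewrite /ball /= distrC.
  have iy : inf (f @` A) <= y := ge_inf hinf.2 fy.
  by rewrite ger0_norm ?subr_ge0 // ltrBlDl.
move=> [x Ax fx]; exists x => // y Ay; rewrite fx; apply: ge_inf; first exact: hinf.2.
by exists y.
Qed.

Lemma meval_continuous n (f : {mpoly R[n.+1]}) : continuous (fun a : 'rV[R]_n.+1 => f.@[a 0]).
Proof.
pose ok (f : {mpoly R[n.+1]}) := continuous (fun a : 'rV[R]_n.+1 => f.@[a 0]).
rewrite -/(ok f).
have okM f1 g : ok f1 -> ok g -> ok (f1 * g).
  rewrite /ok => hf hg.
  rewrite (_ : (fun a : 'rV_n.+1 => _) = (fun a : 'rV_n.+1 => f1.@[a 0] * g.@[a 0])).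
    by move=> a; apply: continuousM; [exact: hf|exact: hg].
  by apply/funext => a; rewrite mevalM.
have okD f1 g : ok f1 -> ok g -> ok (f1 + g).
  rewrite /ok => hf hg.
  rewrite (_ : (fun a : 'rV_n.+1 => _) = (fun a : 'rV_n.+1 => f1.@[a 0] + g.@[a 0])).
    by move=> a; apply: continuousD; [exact: hf|exact: hg].
  by apply/funext => a; rewrite mevalD.
have okC c : ok c%:MP.
  rewrite /ok (_ : (fun a : 'rV_n.+1 => _) = (fun=> c)); first exact: cst_continuous.
  by apply/funext => a; rewrite mevalC.
have okX i : ok 'X_i.
  rewrite /ok (_ : (fun a : 'rV_n.+1 => _) = (fun a : 'rV_n.+1 => a 0 i)); first exact: coord_continuous.
  by apply/funext => a; rewrite mevalXU.
have okXm m : ok 'X_[m].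
  rewrite mpolyXE_id; elim/big_ind : _ => // [|i _]; first exact: (okC 1).
  by elim: (m i) => [|k IH]; rewrite ?expr0 ?exprS; [exact: (okC 1)|exact: okM].
elim/mpolyind : f => [|c m f _ _ IH]; first by rewrite -mpolyC0; exact: okC.
by apply: okD => //; rewrite -mul_mpolyC; apply: okM.
Qed.

Section Cone.
Variables (S : set 'rV[R]_3) (e : 'rV[R]_3) (M : R).
Hypotheses (S0 : S 0) (SZ : forall k s, 0 <= k -> S s -> S (k *: s)).
Hypotheses (Scl : closed S) (Sbd : forall s i, S s -> `|s 0 i| <= M * pairing s e).
Hypothesis (M0 : 0 < M).

(** The cone generated by S: three summands suffice in dimension 3, and a fixed number of them gives
    access to compactness. *)
Definition sum3_of (l : 'rV[R]_3) : Prop :=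
  exists s1 s2 s3, [/\ S s1, S s2, S s3 & l = s1 + s2 + s3].

Lemma sum3_of_scale k l : 0 <= k -> sum3_of l -> sum3_of (k *: l).
Proof.
move=> k0 [s1 [s2 [s3 [h1 h2 h3 ->]]]].
by exists (k *: s1), (k *: s2), (k *: s3); split; rewrite ?scalerDr //; apply: SZ.
Qed.

Lemma caratheodory l s : sum3_of l -> S s -> sum3_of (l + s).
Proof.
move=> [s1 [s2 [s3 [h1 h2 h3 ->]]]] h4.
pose t : 'I_4 -> 'rV[R]_3 := nth 0 [:: s1; s2; s3; s].
have tS i : S (t i) by case: i => [[|[|[|[]]]]] //= ?.
pose T : 'M[R]_(4, 3) := \matrix_i t i.
have [c c0 cT] : exists2 c : 'rV[R]_4, c != 0 & c *m T = 0.
  have : \rank (kermx T) != 0%N.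
    by rewrite mxrank_ker -lt0n subn_gt0 (leq_ltn_trans (rank_leq_col T)).
  rewrite mxrank_eq0 => /rowV0Pn[v /sub_kermxP vT v0]; by exists v.
have rel : \sum_i c 0 i *: t i = 0.
  by rewrite -[RHS]cT mulmx_sum_row; apply: eq_bigr => i _; rewrite rowK.
have [b [b1 hb]] : exists b : 'I_4 -> R, (exists i, 0 < b i) /\ \sum_i b i *: t i = 0.
  have [/existsP[i ci]|/existsPn cn] := boolP [exists i, 0 < c 0 i].
    by exists (c 0); split=> //; exists i.
  have [i ci] : exists i, c 0 i != 0.
    apply/existsP; apply: contraR c0 => /existsPn h; apply/eqP/rowP => i.
    by rewrite mxE; apply/eqP; move: (h i); rewrite negbK.
  exists (fun i => - c 0 i); split.
    by exists i; rewrite oppr_gt0 lt_def eq_sym ci leNgt cn.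
  by under eq_bigr do rewrite scaleNr; rewrite sumrN rel oppr0.
case: b1 => i0 bi0.
(* The largest coefficient: subtracting the relation divided by it keeps all coefficients 1 - b i /
   b i1 non-negative and removes the summand [i1]. *)
have [i1 bi1 hmin] : exists2 i1, 0 < b i1 & forall i, 0 < b i -> (b i1)^-1 <= (b i)^-1.
  by case: (@arg_minP _ _ _ i0 (fun i => 0 < b i) (fun i => (b i)^-1) bi0) => i bi hi; exists i.
pose g i := (1 - (b i1)^-1 * b i) *: t i.
have gS i : S (g i).
  apply: SZ => //; rewrite subr_ge0.
  have [bi|bi] := ltP 0 (b i).
    by rewrite -(mulVf (lt0r_neq0 bi)) ler_pM2r // hmin.
  by apply: le_trans ler01; rewrite mulr_ge0_le0 // invr_ge0 ltW.
have g1 : g i1 = 0 by rewrite /g mulVf ?subrr ?scale0r // gt_eqF.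
have gsum : \sum_i g i = s1 + s2 + s3 + s.
  under eq_bigr do rewrite /g scalerBl scale1r -scalerA.
  rewrite sumrB -scaler_sumr hb scaler0 subr0.
  by rewrite !big_ord_recl big_ord0 addr0 /t /= !addrA.
rewrite -gsum !big_ord_recl big_ord0 addr0; move: g1.
have [E|] := eqVneq i1 ord0.
  rewrite E => ->; rewrite add0r addrA.
  by eexists _, _, _; split; last reflexivity.
have [E _|] := eqVneq i1 (lift ord0 ord0).
  rewrite E => ->; rewrite add0r addrA.
  by eexists _, _, _; split; last reflexivity.
have [E _ _|] := eqVneq i1 (lift ord0 (lift ord0 ord0)).
  rewrite E => ->; rewrite add0r addrA.
  by eexists _, _, _; split; last reflexivity.
move=> n2 n1 n0 g1; have E : i1 = lift ord0 (lift ord0 (lift ord0 ord0)).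
  apply: val_inj; move: n0 n1 n2; rewrite -!(inj_eq val_inj) /=.
  by case: (i1) => [[|[|[|[|]]]]].
rewrite -E g1 addr0 addrA.
by eexists _, _, _; split; last reflexivity.
Qed.

(** The first-order condition at a minimum of a squared distance. A negative b is refuted by a step
    eps <= 1 with eps c <= - b. *)
Lemma quadratic_ge0 (b c : R) :
  (forall eps, 0 < eps <= 1 -> 0 <= 2 * eps * b + eps ^+ 2 * c) -> 0 <= b.
Proof.
move=> h; rewrite leNgt; apply/negP => b0.
have den : 0 < `|c| + `|b| + 1 by rewrite ltr_wpDl // addr_ge0.
pose eps := - b / (`|c| + `|b| + 1).
have nb : `|b| = - b by rewrite ltr0_norm.
have e0 : 0 < eps by rewrite divr_gt0 // oppr_gt0.
have e1 : eps <= 1 by rewrite ler_pdivrMr // mul1r nb; have := normr_ge0 c; lra.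
have := h eps; rewrite e0 e1 => /(_ isT).
have -> : 2 * eps * b + eps ^+ 2 * c = eps * (2 * b + eps * c) by ring.
rewrite pmulr_rge0 // leNgt => /negP; apply.
have : eps * c <= - b.
  apply: le_trans (_ : eps * (`|c| + `|b| + 1) <= _).
    by rewrite ler_pM2l //; have := ler_norm c; have := normr_ge0 b; lra.
  by rewrite divfK // gt_eqF.
lra.
Qed.

Lemma pairing_self_gt0 (a : 'rV[R]_3) : a != 0 -> 0 < pairing a a.
Proof. by move=> /sum_sqr_gt0; congr (0 < _); apply: eq_bigr => i _; rewrite expr2. Qed.

(** a = w - l for the point w of the cone nearest to l. Moving w along s in S gives s(a) >= 0, and
    shrinking w gives w(a) <= 0, so l(a) = w(a) - |a|^2 < 0. *)
Lemma sum3_of_separation l : ~ sum3_of l ->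
  exists2 a, forall s, S s -> 0 <= pairing s a & pairing l a < 0.
Proof.
move=> nl.
have se0 s : S s -> 0 <= pairing s e.
  by move=> Ss; rewrite -(pmulr_rge0 _ M0) (le_trans _ (Sbd ord0 Ss)).
pose sq (v : 'rV[R]_3) := pairing v v.
have sqE : sq = fun v => (\sum_i 'X_i * 'X_i : {mpoly R[3]}).@[v 0].
  apply/funext => v; rewrite raddf_sum; apply: eq_bigr => i _.
  by rewrite /= mevalM !mevalXU.
have sq_cont : continuous sq by rewrite sqE; exact: meval_continuous.
have sq0 v : 0 <= sq v by rewrite sumr_ge0 // => i _; rewrite -expr2 sqr_ge0.
(* Only points y at least as close to l as 0 matter. For these each coordinate of y - l is at most
   |l|^2 + 1 in absolute value, so y(e) <= N, and the same holds for the summands of y. *)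
pose N := `|pairing l e| + \sum_i (sq l + 1) * `|e 0 i|.
pose K := S `&` [set s | pairing s e <= N].
have Kcl : closed K.
  apply: closedI => //.
  rewrite (_ : [set s | pairing s e <= N] = (fun v : 'rV[R]_3 => (\sum_i e 0 i *: 'X_i : {mpoly R[3]}).@[v 0]) @^-1` [set x | x <= N]).
    by apply: preimage_closed; [move=> ? _; exact: meval_continuous|exact: closed_le].
  apply/funext => v /=; congr (_ <= N); rewrite raddf_sum; apply: eq_bigr => i _.
  by rewrite /= mevalZ mevalXU mulrC.
have Kbd : bounded_set K.
  exists (M * N); split; first exact: num_real.
  move=> x Nx s [Ss /= sN]; apply: le_trans (ltW Nx).
  rewrite /Num.norm /= mx_normrE; apply: bigmax_le => [|[i0 i] _ /=].
    by rewrite mulr_ge0 ?(ltW M0) // (le_trans (se0 _ Ss)).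
  rewrite ord1; apply: le_trans (Sbd i Ss) _.
  by rewrite ler_pM2l.
have Kc : compact K by apply: bounded_closed_compact.
have K0 : K 0.
  split; first exact: S0.
  rewrite /= /pairing big1 => [|i _]; last by rewrite mxE mul0r.
  rewrite addr_ge0 // sumr_ge0 // => i _.
  by rewrite mulr_ge0 // addr_ge0.
pose phi (t : ('rV[R]_3 * 'rV[R]_3) * 'rV[R]_3) := sq (t.1.1 + t.1.2 + t.2 - l).
have phi_cont : continuous phi.
  move=> t; apply: (@continuous_comp _ _ _ (fun t : ('rV[R]_3 * 'rV[R]_3) * 'rV[R]_3 => t.1.1 + t.1.2 + t.2 - l) sq);
    last exact: sq_cont.
  have c11 : continuous (fun t : ('rV[R]_3 * 'rV[R]_3) * 'rV[R]_3 => t.1.1).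
    by move=> x; apply: (@continuous_comp _ _ _ fst fst); exact: cvg_fst.
  have c12 : continuous (fun t : ('rV[R]_3 * 'rV[R]_3) * 'rV[R]_3 => t.1.2).
    by move=> x; apply: (@continuous_comp _ _ _ fst snd); [exact: cvg_fst|exact: cvg_snd].
  have c2 : continuous (fun t : ('rV[R]_3 * 'rV[R]_3) * 'rV[R]_3 => t.2).
    by move=> x; exact: cvg_snd.
  apply: continuousB; last exact: cst_continuous.
  apply: continuousD; last exact: c2.
  by apply: continuousD; [exact: c11|exact: c12].
have [[[s1 s2] s3] [[Ks1 Ks2] Ks3] hmin] := compact_argmin
  (compact_setX (compact_setX Kc Kc) Kc) (ex_intro _ ((0, 0), 0) (conj (conj K0 K0) K0)) phi_cont.
have [w wE] : exists w, w = s1 + s2 + s3 by exists (s1 + s2 + s3).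
have wT : sum3_of w by exists s1, s2, s3; split; [exact: Ks1.1|exact: Ks2.1|exact: Ks3.1|].
have min_all y : sum3_of y -> sq (w - l) <= sq (y - l).
  move=> [t1 [t2 [t3 [h1 h2 h3 yE]]]].
  have [big|small] := ltP (sq l) (sq (y - l)).
    apply: le_trans (ltW big); have := hmin ((0, 0), 0) (conj (conj K0 K0) K0).
    rewrite /phi /= !addr0 add0r -wE; congr (_ <= _).
    by rewrite /sq -scaleN1r pairingZl pairingZr; ring.
  have ye : pairing y e <= N.
    have -> : y = l + (y - l) by rewrite addrC subrK.
    rewrite pairingDl /N lerD ?ler_norm // ler_sum // => i _.
    apply: le_trans (ler_norm _) _; rewrite normrM ler_wpM2r //.
    have : (y - l) 0 i ^+ 2 <= sq (y - l).
      rewrite /sq /pairing (bigD1 i) //= -expr2 lerDl sumr_ge0 // => j _.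
      by rewrite -expr2 sqr_ge0.
    rewrite -real_normK ?num_real //; set z := `|_|.
    by have := sqr_ge0 (z - 2^-1); rewrite sqrrB; lra.
  have [e1 e2 e3] : [/\ 0 <= pairing t1 e, 0 <= pairing t2 e & 0 <= pairing t3 e].
    by split; apply: se0.
  have Kt1 : K t1 by split=> //=; move: ye; rewrite yE !pairingDl; lra.
  have Kt2 : K t2 by split=> //=; move: ye; rewrite yE !pairingDl; lra.
  have Kt3 : K t3 by split=> //=; move: ye; rewrite yE !pairingDl; lra.
  by have := hmin ((t1, t2), t3) (conj (conj Kt1 Kt2) Kt3); rewrite /phi /= -yE -wE.
have [a aE] : exists a, a = w - l by exists (w - l).
have a0 : a != 0.
  by apply: contra_not_neq nl => /eqP; rewrite aE subr_eq0 => /eqP <-.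
exists a.
  move=> s Ss; rewrite pairingC; apply: (@quadratic_ge0 _ (pairing s s)) => eps /andP[eps0 _].
  have := min_all _ (caratheodory wT (SZ (ltW eps0) Ss)).
  rewrite (addrAC w) -aE /sq !(pairingDl, pairingDr, pairingZl, pairingZr) (pairingC s a).
  by rewrite -subr_ge0; congr (0 <= _); ring.
have aw : 0 <= - pairing a w.
  apply: (@quadratic_ge0 _ (pairing w w)) => eps /andP[eps0 eps1].
  have := min_all _ (sum3_of_scale (_ : 0 <= 1 - eps) wT).
  rewrite subr_ge0 => /(_ eps1).
  have -> : (1 - eps) *: w - l = a + (- eps) *: w.
    by rewrite scalerBl scale1r scaleNr addrAC aE.
  rewrite -aE /sq !(pairingDl, pairingDr, pairingZl, pairingZr) (pairingC w a).
  by rewrite -subr_ge0; congr (0 <= _); ring.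
have -> : l = w + (-1) *: a by rewrite scaleN1r aE opprB addrC subrK.
rewrite pairingDl pairingZl (pairingC w a); have := pairing_self_gt0 a0; move: aw.
lra.
Qed.

End Cone.
End ConeSeparation.

Section ConvexCones.
Variable R : realType.

Lemma dual_convex_cone n (C : set 'rV[R]_n) : convex_cone (dual_cone C).
Proof.
split.
- by exists 0 => x _; rewrite /pairing big1 // => i _; rewrite mxE mul0r.
- move=> x y t; rewrite !inE => hx hy c Cc.
  rewrite (_ : conv t x y = t%:inum *: (x : 'rV[R]_n) + (1 - t%:inum) *: (y : 'rV[R]_n)) //.
  have t0 : 0 <= t%:inum by [].
  have t1 : 0 <= 1 - t%:inum by rewrite subr_ge0.
  by rewrite pairingDl !pairingZl; apply: addr_ge0; apply: mulr_ge0; rewrite ?hx ?hy.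
- by move=> k x k0 hx c Cc; rewrite pairingZl mulr_ge0 // hx.
Qed.

Lemma convex_cone_add n (A : set 'rV[R]_n) x y : convex_cone A -> A x -> A y -> A (x + y).
Proof.
move=> [_ Aconv Ascale] Ax Ay.
have h0 : (0 : R) <= 2^-1 by rewrite invr_ge0.
have h1 : (2^-1 : R) <= 1 by rewrite invf_le1 // ler1n.
have Axy : A (2^-1 *: x + (1 - 2^-1) *: y).
  by have := Aconv x y (Itv01 h0 h1); rewrite !inE; exact.
suff -> : x + y = 2 *: (2^-1 *: x + (1 - 2^-1) *: y) by apply: Ascale.
rewrite scalerDr !scalerA mulfV ?pnatr_eq0 // mulrBr mulfV ?pnatr_eq0 // mulr1 scale1r.
by rewrite (_ : 2 - 1 = 1) ?scale1r //; ring.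
Qed.

End ConvexCones.

(** * The dual of the hyperbolicity cone *)

Local Notation rc := (real_complex _).

Theorem theorem4p9 (R : realType) (p : {mpoly R[3]}) (e : 'rV[R]_3)
  (p_irr : irreducible_mpoly p)
  (p_hyp : hyperbolic p e)
  (p_pos : 0 < p.@[e 0]) :
  dual_cone (hyperbolicity_cone p e) =
  cc (real_points (affine_cone (dual_variety (proj_zeros [set p])))
      `&` half_space e).
Proof.
have [[d p_homog] peR root_real] := p_hyp.
have pe0 : ceval p (cvec e) != 0 by rewrite ceval_real rc_eq0.
have p_real (a : 'rV[R]_3) (z : R[i]) : ceval p (z *: cvec e - cvec a) = 0 -> z \is Num.real.
  by move=> h; apply: (root_real a); apply/line_rootE.
have coneE a : hyperbolicity_cone p e a <-> forall z, ceval p (z *: cvec e - cvec a) = 0 -> 0 <= z.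
  by split=> h z hz; apply: h; apply/line_rootE.
have smooth := smooth_point_exists p_irr p_homog peR.
have dualE := real_dualE p_irr p_homog peR smooth.
set S := _ `&` half_space e; set D := dual_cone _.
have SD : S `<=` D.
  move=> l [/dualE Sl le] c /coneE hc; rewrite leNgt; apply/negP => lc.
  have [e' ie' le'] : exists2 e', inner_cone p e e' & pairing l e' = 0.
    have [le0|le0] := eqVneq (pairing l e) 0.
      by exists e => //; exact: (inner_cone_base p_homog pe0).
    have lep : 0 < pairing l e by rewrite lt_def le0.
    (* The zero of l on the ray from c in direction e. Adding tau e shifts the roots of p(z e - c)
       by tau > 0, so this point is interior. *)
    pose tau := - pairing l c / pairing l e.
    have tau0 : 0 < tau by rewrite divr_gt0 // oppr_gt0.
    exists (c + tau *: e); last by rewrite pairingDr pairingZr divfK // subrr.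
    move=> z hz; have h : ceval p ((z - rc tau) *: cvec e - cvec c) = 0.
      rewrite -hz; congr ceval; rewrite map_mxD map_mxZ scalerBl opprD addrA.
      by rewrite addrAC.
    by apply: lt_le_trans (_ : rc tau <= z); [rewrite rc_gt0|rewrite -subr_ge0; exact: hc h].
  have l0 : l != 0.
    apply: contraTneq lc => ->; rewrite /pairing big1 ?ltxx // => i _.
    by rewrite mxE mul0r.
  have pe' : p.@[e' 0] != 0 by rewrite -rc_eq0 -ceval_real; exact: (inner_cone_neq0 p_homog ie').
  have e'0 := base_neq0 p_irr p_homog pe'.
  have [f fv fl] := real_dual_separation p_irr p_homog pe0 p_real ie' l0 e'0 le'.
  by move: fl; rewrite (Sl f fv) eqxx.
have [y0 Xy0 gy0] := smooth.
have Ty0 := smooth_tangent p_irr p_homog peR smooth Xy0 gy0.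
have S0 : S 0.
  split; last by rewrite /half_space /= /pairing big1 // => i _; rewrite mxE mul0r.
  apply/dualE => f [[j hf] fT].
  have -> : cvec (0 : 'rV[R]_3) = 0 *: grad p y0 by rewrite scale0r map_mx0.
  by rewrite (ceval_homogZ _ _ hf) (fT _ Ty0) mulr0.
have SZ k s : 0 <= k -> S s -> S (k *: s).
  move=> k0 [/dualE h1 h2]; split; last by rewrite /half_space /= pairingZl mulr_ge0.
  apply/dualE => f fv; have [[j hf] _] := fv.
  by rewrite map_mxZ (ceval_homogZ _ _ hf) (h1 f fv) mulr0.
have Scl : closed S.
  have -> : S = \bigcap_(f in vanishing (tangent_lines p)) ((fun a : 'rV[R]_3 => f.@[a 0]) @^-1` [set x | x = 0])
     `&` ((fun a : 'rV[R]_3 => (\sum_i e 0 i *: 'X_i : {mpoly R[3]}).@[a 0]) @^-1` [set x | 0 <= x]).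
    have pE a : pairing a e = (\sum_i e 0 i *: 'X_i : {mpoly R[3]}).@[a 0].
      by rewrite raddf_sum; apply: eq_bigr => i _; rewrite /= mevalZ mevalXU mulrC.
    apply/seteqP; split=> b [hb1 hb2]; split.
    - by move=> f fv /=; apply/eqP; rewrite -rc_eq0 -ceval_real; apply/eqP/(dualE b).1.
    - by rewrite /= -pE.
    - by apply/dualE => f fv; rewrite ceval_real (hb1 f fv) rmorph0.
    - by rewrite /half_space /= pE.
  apply: closedI.
    apply: closed_bigI => f _; apply: preimage_closed; last exact: closed_eq.
    by move=> x _; exact: meval_continuous.
  by apply: preimage_closed; [move=> x _; exact: meval_continuous|exact: closed_ge].
(* By [SD] a form s in S is non-negative at e plus or minus a small multiple of each basis vector,
   since e is interior. *)
have [M M0 Sbd] : exists2 M, 0 < M & forall s i, S s -> `|s 0 i| <= M * pairing s e.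
  have /choice[m hm] : forall i, exists m : R, 0 < m /\ forall s, S s -> `|s 0 i| <= m * pairing s e.
    move=> i; have [dl dl0 hdl] := inner_cone_open p_homog pe0 p_real (delta_mx 0 i) (inner_cone_base p_homog pe0).
    have dl20 : 0 < dl / 2 by rewrite divr_gt0.
    exists (dl / 2)^-1; split=> [|s Ss]; first by rewrite invr_gt0.
    have pd mu : `|mu| < dl -> 0 <= pairing s e + mu * s 0 i.
      move=> /hdl ie; have /(_ (e + mu *: delta_mx 0 i)) := SD _ Ss.
      rewrite pairingDr pairingZr [pairing s (delta_mx _ _)](_ : _ = s 0 i); last first.
        rewrite /pairing (bigD1 i) //= mxE !eqxx mulr1 big1 ?addr0 // => j ji.
        by rewrite mxE (negPf ji) mulr0.
      by apply; apply/coneE => z /ie /ltW.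
    rewrite mulrC ler_pdivlMr // mulrC.
    have n1 : `|dl / 2| < dl by rewrite gtr0_norm // half_lt.
    have := pd (dl / 2) n1; have := pd (- (dl / 2)); rewrite normrN => /(_ n1).
    have [s0|s0] := ger0P (s 0 i); rewrite ?mulrN ?mulNr; lra.
  have Mi i : m i <= \sum_j m j.
    by rewrite (bigD1 i) //= lerDl sumr_ge0 // => j _; exact: ltW (hm j).1.
  exists (\sum_i m i); first exact: lt_le_trans (hm ord0).1 (Mi ord0).
  move=> s i Ss; apply: le_trans ((hm i).2 s Ss) _.
  by rewrite ler_wpM2r //; exact: Ss.2.
apply/seteqP; split=> l hl; last first.
  by apply: (hl D); split=> //; exact: dual_convex_cone.
have [[s1 [s2 [s3 [h1 h2 h3 ->]]]]|nl] := pselect (sum3_of S l).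
  by move=> A [Acone SA]; do 2?[apply: convex_cone_add => //]; apply: SA.
exfalso.
have [a Sa la] := sum3_of_separation S0 SZ Scl Sbd M0 nl.
have le : 0 <= pairing l e.
  apply: hl; apply/coneE => z /(inner_cone_base p_homog pe0); exact: ltW.
(* The shift by eps e compensates for the perturbation: forms of S with value 1 at e will stay
   non-negative at [a2]. It raises l(a) by at most half of |l(a)|; the summand 1 covers l(e) = 0. *)
pose eps := - pairing l a / (2 * (pairing l e + 1)).
have le1 : 0 < pairing l e + 1 by rewrite ltr_wpDl.
have eps0 : 0 < eps by rewrite divr_gt0 ?oppr_gt0 // mulr_gt0.
have la1 : pairing l (a + eps *: e) <= pairing l a / 2.
  rewrite pairingDr pairingZr.
  have : eps * pairing l e <= - pairing l a / 2.
    apply: le_trans (_ : eps * (pairing l e + 1) <= _); first by rewrite ler_pM2l // lerDl.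
    by rewrite /eps invfM mulrA divfK // gt_eqF.
  lra.
(* The first bound gives |s(v)| <= eps for the three coordinates of a form s in S with s(e) = 1, the
   second one keeps l negative at [a2]. *)
pose eta := Num.min (eps / (3 * M)) (- pairing l a / 2 / (\sum_i `|l 0 i| + 1)).
have den0 : 0 < \sum_i `|l 0 i| + 1 by rewrite ltr_wpDl // sumr_ge0.
have eta0 : 0 < eta.
  by rewrite lt_min !divr_gt0 ?mulr_gt0 ?oppr_gt0.
have [v vs hv] := generic_perturbation p_irr p_homog peR (a + eps *: e) eta0.
set a2 := a + eps *: e + v in hv.
have la2 : pairing l a2 < 0.
  rewrite /a2 pairingDr; have : pairing l v < - pairing l a / 2; last by move: la1; lra.
  apply: le_lt_trans (_ : (\sum_i `|l 0 i|) * eta < _).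
    rewrite /pairing mulr_suml ler_sum // => i _; apply: le_trans (ler_norm _) _.
    by rewrite normrM ler_wpM2l // ltW.
  apply: lt_le_trans (_ : (\sum_i `|l 0 i| + 1) * eta <= _).
    by rewrite ltr_pM2r // ltrDl.
  by rewrite mulrC -ler_pdivlMr // ge_min lexx orbT.
have : ~ hyperbolicity_cone p e a2 by move=> /hl; rewrite leNgt la2.
move=> na2.
have [z hz zneg] : exists2 z, ceval p (z *: cvec e - cvec a2) = 0 & ~ (0 <= z).
  apply: contrapT => h; apply: na2; apply/coneE => z hz.
  by apply: contrapT => zneg; apply: h; exists z.
have /complex_realP[t1 zE] := p_real _ _ hz.
have t10 : t1 < 0 by rewrite ltNge; apply/negP => t1ge; apply: zneg; rewrite zE ler0c.
pose x := t1 *: e - a2.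
have xE : z *: cvec e - cvec a2 = cvec x by rewrite zE map_mxB map_mxZ.
have [x0 px] := hv z; rewrite xE in hz x0 px; have dpx := px hz.
pose m : 'rV[R]_3 := \row_i (p^`M(i)).@[x 0].
have mE : grad p (cvec x) = cvec m.
  by apply/rowP => i; rewrite !mxE ceval_real.
have pm w : dirder p (cvec x) (cvec w) = rc (pairing m w).
  rewrite -pairing_grad mE /pairing rmorph_sum; apply: eq_bigr => i _.
  by rewrite !mxE rmorphM.
have me0 : pairing m e != 0 by rewrite -rc_eq0 -[_%:C%C]pm.
have gx : grad p (cvec x) != 0.
  apply: contraNneq dpx => g0; rewrite -pairing_grad g0 /pairing big1 // => i _.
  by rewrite mxE mul0r.
have Xx : proj_zeros [set p] (cvec x) by apply/proj_zerosP.
have Tx := smooth_tangent p_irr p_homog peR smooth Xx gx.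
(* m(e) may have either sign, but real points of the dual cone admit all real scalars, so the
   tangent can be normalized to s(e) = 1. As s(x) = 0 by Euler, s takes the value t1 < 0 at [a2]. *)
pose s := (pairing m e)^-1 *: m.
have se : pairing s e = 1 by rewrite pairingZl mulVf.
have Ss : S s.
  split; last by rewrite /half_space /= se ler01.
  apply/dualE => f fv; have [[j hf] fT] := fv.
  by rewrite map_mxZ -mE (ceval_homogZ _ _ hf) (fT _ Tx) mulr0.
have sx : pairing s x = 0.
  have := euler (cvec x) p_homog; rewrite hz mulr0 pm => /eqP; rewrite rc_eq0 => /eqP mx.
  by rewrite pairingZl mx mulr0.
have sa2 : pairing s a2 = t1.
  have -> : a2 = t1 *: e + (-1) *: x by rewrite scaleN1r opprB addrC subrK.
  by rewrite pairingDr !pairingZr sx se mulr0 addr0 mulr1.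
have : - eps <= pairing s v.
  have : - pairing s v <= eps; last lra.
  apply: le_trans (_ : \sum_(i < 3) M * (eps / (3 * M)) <= _).
    rewrite /pairing -sumrN ler_sum // => i _; apply: le_trans (ler_norm _) _.
    rewrite normrN normrM; apply: ler_pM => //.
      by have := Sbd s i Ss; rewrite se mulr1.
    by apply: ltW; apply: lt_le_trans (vs i) _; rewrite ge_min lexx.
  have -> : \sum_(i < 3) M * (eps / (3 * M)) = eps; last exact: lexx.
  by rewrite sumr_const card_ord -mulr_natl; field; rewrite gt_eqF.
have := Sa s Ss; move: sa2; rewrite /a2 !pairingDr pairingZr se mulr1; lra.
Qed.
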